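(* Let $n\ge3$ and let $d$ be an integer with $1\le d<n$. There is a constant $C$ depending only on $n$ and $d$ such that the following holds. Let $\Omega\subset\mathbb{R}^n$ be open, let $\psi\in C^2(\Omega)$ be a convex function with $\psi\ge0$ and $\det D^2\psi\ge\lambda^{-2}>0$ in $\Omega$, and assume that $\psi(x_0)=0$ for some $x_0\in\Omega$, with $\delta:=\mathrm{dist}(x_0,\partial\Omega)>0$. Let $H$ be an affine subspace of dimension $d$ passing through $x_0$. Then for all $0<\ell\le\frac{\delta}{2}$, the quantity $$\gamma=\frac{\sup_{x\in B_\ell(x_0)\cap H}\psi(x)}{\|\nabla\psi\|_{L^\infty(\Omega)}}$$ satisfies $$\ell^{2d}\,\varphi(\delta/\gamma)\le C\,\lambda^2\,\|\nabla\psi\|_{L^\infty(\Omega)}^n\,\delta^{2d-n},\qquad\text{where}\quad \varphi(s):=s^{2d-n}\int_0^s\frac{r^{n-d-1}}{(r+1)^d}\,dr .$$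
   Context: $B_\ell(x_0)$ is the ball in $\mathbb{R}^n$ of radius $\ell$ centred at $x_0$. It is understood that $\|\nabla\psi\|_{L^\infty(\Omega)}<\infty$. *)

(* Defs.v *)
From HB Require Import structures.
From mathcomp Require Import all_boot all_order all_algebra.
From mathcomp Require Import all_classical all_reals all_analysis.

Set Implicit Arguments.
Unset Strict Implicit.
Unset Printing Implicit Defensive.

Import Order.TTheory GRing.Theory Num.Theory.
Import numFieldNormedType.Exports.

Local Open Scope classical_set_scope.
Local Open Scope ring_scope.

(* The library's norm on 'rV[R]_n is the sup norm; it induces the usual
   topology, so [open], [closure], limits and derivatives are the usual ones,
   but lengths, balls and distances need the Euclidean norm. *)
Definition enorm (R : realType) (n : nat) (x : 'rV[R]_n) : R :=
  Num.sqrt (\sum_(i < n) x 0 i ^+ 2).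

Definition eball (R : realType) (n : nat) (x0 : 'rV[R]_n) (r : R) :
    set 'rV[R]_n :=
  [set x | enorm (x - x0) < r].

Definition boundary (T : topologicalType) (A : set T) : set T :=
  closure A `\` interior A.

(* [+oo] when [A] is empty. *)
Definition edist_to (R : realType) (n : nat) (x : 'rV[R]_n)
    (A : set 'rV[R]_n) : \bar R :=
  ereal_inf [set (enorm (x - y))%:E | y in A].

Definition partial (R : realType) (n : nat) (i : 'I_n) (f : 'rV[R]_n -> R) :
    'rV[R]_n -> R :=
  'D_(delta_mx 0 i : 'rV[R]_n) f.

Definition grad (R : realType) (n : nat) (f : 'rV[R]_n -> R)
    (x : 'rV[R]_n) : 'rV[R]_n :=
  \row_(i < n) partial i f x.

Definition hessian (R : realType) (n : nat) (f : 'rV[R]_n -> R)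
    (x : 'rV[R]_n) : 'M[R]_n :=
  \matrix_(i < n, j < n) partial i (partial j f) x.

(* Functions on [Omega] are represented by total functions whose values outside
   [Omega] are irrelevant.  For open [Omega], partial derivatives and continuity
   at a point of [Omega] only involve values inside [Omega]. *)
Definition C2_on (R : realType) (n : nat) (Omega : set 'rV[R]_n)
    (f : 'rV[R]_n -> R) : Prop :=
  forall x, Omega x ->
    {for x, continuous f} /\
    forall i : 'I_n,
      [/\ derivable f x (delta_mx 0 i : 'rV[R]_n),
          {for x, continuous (partial i f)} &
          forall j : 'I_n,
            derivable (partial i f) x (delta_mx 0 j : 'rV[R]_n) /\
            {for x, continuous (partial j (partial i f))}].

(* [Omega] need not be convex, so this asks for convexity on every convex subset
   of [Omega], i.e. along every segment contained in [Omega]. *)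
Definition convex_on (R : realType) (n : nat) (Omega : set 'rV[R]_n)
    (f : 'rV[R]_n -> R) : Prop :=
  forall K : set 'rV[R]_n,
    K `<=` Omega -> convex_set K -> convex_function K f.

(* Sets of n-dimensional Lebesgue measure zero: they have countable covers by
   closed boxes of arbitrarily small total volume. *)
Definition lebesgue_null (R : realType) (n : nat) (A : set 'rV[R]_n) : Prop :=
  forall e : R, 0 < e ->
    exists a b : nat -> 'rV[R]_n,
      [/\ forall k i, a k 0 i <= b k 0 i,
          A `<=` \bigcup_k [set x | forall i, a k 0 i <= x 0 i <= b k 0 i] &
          (\sum_(0 <= k <oo) (\prod_(i < n) (b k 0 i - a k 0 i))%:E <= e%:E)%E].

(* Essential supremum of the Euclidean length of [F] over [Omega]; [+oo] when
   [F] is not essentially bounded. *)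
Definition Linfty_norm (R : realType) (n : nat) (Omega : set 'rV[R]_n)
    (F : 'rV[R]_n -> 'rV[R]_n) : \bar R :=
  ereal_inf [set M%:E | M in [set M : R |
    0 <= M /\ lebesgue_null [set x | Omega x /\ M < enorm (F x)]]].

Definition affine_subspace (R : realType) (n d : nat) (H : set 'rV[R]_n) :
    Prop :=
  exists (p : 'rV[R]_n) (V : {vspace 'rV[R]_n}),
    \dim V = d /\ H = [set p + v | v in [set v | v \in V]].

(* The exponent of [s] is an integer which may be negative. *)
Definition phi (R : realType) (n d : nat) (s : R) : R :=
  s ^ (2 * d%:Z - n%:Z) *
  \int[@lebesgue_measure R]_(r in `[0, s]) (r ^+ (n - d - 1) / (r + 1) ^+ d).

(* Main.v *)
Require Import Defs.
From HB Require Import structures.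
From mathcomp Require Import all_boot all_order all_algebra.
From mathcomp Require Import all_classical all_reals all_analysis.
From mathcomp Require Import measurable_realfun.
From mathcomp Require Import ring lra zify.

Set Implicit Arguments.
Unset Strict Implicit.
Unset Printing Implicit Defensive.

Import Order.TTheory GRing.Theory Num.Theory.
Import numFieldNormedType.Exports.

Local Open Scope classical_set_scope.
Local Open Scope ring_scope.

(* A barrier argument.  In coordinates z - x0 = (x, y) along H and orthogonal to
   it, put t = |y|, D = delta / 2, and let M bound the gradient.  On the cylinder
   |x|^2 <= ell^2 / 2, t <= D one has psi <= M (gamma + t), and psi is compared with
     W = 16 M (gamma + t) (|x|^2 / ell^2 - 1/4) + 2 gamma M + F(t),
   where F(0) = F'(0) = 0, F'(D) = K M and F'' is proportional to
   t^(n-d-1) / (gamma + t)^d, the integrand of phi up to scaling.  For K large,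
   W >= psi on the boundary of the cylinder while W(x0) < psi(x0), so psi - W has
   an interior maximum.  It is not on the axis t = 0: there W is negative enough
   to force |x|^2 < ell^2 / 4, so that W has a concave kink in y.  Off the axis,
   the second derivatives of psi along an orthonormal basis adapted to H and y/t
   are at most those of W, so by Hadamard's inequality
     lambda^-2 <= (32 M (gamma + t) / ell^2)^d ((4 + K) M / t)^(n-d-1) F''(t),
   from which t cancels, leaving the claim. *)

(** * Euclidean geometry and Hadamard's inequality *)

(** The shape of [F] is forced by the final product. The barrier curves at most like [gamma + t] in
    the [d] directions of [H] and like [1 / t] in the [n - d - 1] directions tangent to the sphere
    [|y| = t]. Nothing is known about where the maximum sits, so the product of the [n] bounds must
    not depend on [t]; this leaves a radial second derivative proportional to
    [t^(n-d-1) / (gamma + t)^d]. Its normalisation, which makes [F'(D)] large enough to beat the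
    term [-4 M (gamma + D)] on the top of the cylinder, divides by the integral of that density, and
    this is how [phi] enters.

    The kink comes from the slope of [W] in [t] at the axis, [16 M (|x|^2 / ell^2 - 1/4)]. The
    maximum of [psi - W] is at least its value [2 gamma M] at [x0], whereas [psi <= gamma M] on the
    axis; together these make the slope at most [-3 M].

    Neither [F] nor [W] is ever differentiated: only symmetric second differences are compared, and
    derivatives are taken of [psi] alone. Hadamard's inequality needs no more than the diagonal
    entries of the Hessian in the adapted basis. *)

Definition dot (R : realType) (n : nat) (u v : 'rV[R]_n) : R :=
  \sum_(i < n) u 0 i * v 0 i.

Section Dot.
Context {R : realType} {n : nat}.
Implicit Types u v w : 'rV[R]_n.

Lemma dotC u v : dot u v = dot v u.
Proof. by apply: eq_bigr => i _; rewrite mulrC. Qed.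

Lemma dotDl u v w : dot (u + v) w = dot u w + dot v w.
Proof. by rewrite -big_split; apply: eq_bigr => i _; rewrite mxE mulrDl. Qed.

Lemma dotDr u v w : dot w (u + v) = dot w u + dot w v.
Proof. by rewrite dotC dotDl !(dotC w). Qed.

Lemma dotZl a u v : dot (a *: u) v = a * dot u v.
Proof. by rewrite mulr_sumr; apply: eq_bigr => i _; rewrite mxE mulrA. Qed.

Lemma dotZr a u v : dot u (a *: v) = a * dot u v.
Proof. by rewrite dotC dotZl dotC. Qed.

Lemma dotNl u v : dot (- u) v = - dot u v.
Proof. by rewrite -scaleN1r dotZl mulN1r. Qed.

Lemma dotNr u v : dot u (- v) = - dot u v.
Proof. by rewrite dotC dotNl dotC. Qed.

Lemma dotBl u v w : dot (u - v) w = dot u w - dot v w.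
Proof. by rewrite dotDl dotNl. Qed.

Lemma dotBr u v w : dot w (u - v) = dot w u - dot w v.
Proof. by rewrite dotDr dotNr. Qed.

Lemma dot0l u : dot 0 u = 0.
Proof. by rewrite -(scale0r 0) dotZl mul0r. Qed.

Lemma dot_suml (I : Type) (r : seq I) (P : pred I) (F : I -> 'rV[R]_n) v :
  dot (\sum_(i <- r | P i) F i) v = \sum_(i <- r | P i) dot (F i) v.
Proof.
apply: (big_morph (fun u => dot u v)); last exact: dot0l.
by move=> a b; rewrite dotDl.
Qed.

Lemma dot_ge0 u : 0 <= dot u u.
Proof. by apply: sumr_ge0 => i _; rewrite -expr2 sqr_ge0. Qed.

Lemma dot_eq0 u : (dot u u == 0) = (u == 0).
Proof.
apply/idP/eqP => [|->]; last by rewrite dot0l.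
rewrite psumr_eq0 => [|i _]; last by rewrite -expr2 sqr_ge0.
move=> /allP h; apply/rowP => i; rewrite mxE.
by have := h i (mem_index_enum _); rewrite /= mulf_eq0 orbb => /eqP.
Qed.

Lemma dot_gt0 u : (0 < dot u u) = (u != 0).
Proof. by rewrite lt_neqAle eq_sym dot_eq0 dot_ge0 andbT. Qed.

Lemma cauchy_schwarz u v : dot u v ^+ 2 <= dot u u * dot v v.
Proof.
have [->|v0] := eqVneq v 0.
  by rewrite (dotC u) !dot0l expr0n mulr0.
have vv : 0 < dot v v by rewrite dot_gt0.
have := dot_ge0 (dot v v *: u - dot u v *: v).
rewrite !(dotBl, dotBr, dotZl, dotZr) (dotC v u).
rewrite (_ : _ - _ = dot v v * (dot u u * dot v v - dot u v ^+ 2)); last by ring.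
by rewrite pmulr_rge0// subr_ge0.
Qed.

Lemma enormE u : enorm u = Num.sqrt (dot u u).
Proof. by congr Num.sqrt; apply: eq_bigr => i _; rewrite expr2. Qed.

Lemma enorm_ge0 u : 0 <= enorm u.
Proof. exact: sqrtr_ge0. Qed.

Lemma sqr_enorm u : enorm u ^+ 2 = dot u u.
Proof. by rewrite enormE sqr_sqrtr// dot_ge0. Qed.

Lemma enorm0 : enorm (0 : 'rV[R]_n) = 0.
Proof. by rewrite enormE dot0l sqrtr0. Qed.

Lemma norm_dot_le u v : `|dot u v| <= enorm u * enorm v.
Proof.
rewrite -(ler_pXn2r (_ : 0 < 2)%N) ?nnegrE ?mulr_ge0 ?enorm_ge0//.
by rewrite exprMn !sqr_enorm real_normK ?num_real// cauchy_schwarz.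
Qed.

Lemma enormZ a u : enorm (a *: u) = `|a| * enorm u.
Proof.
by rewrite !enormE dotZl dotZr mulrA -expr2 sqrtrM ?sqr_ge0// sqrtr_sqr.
Qed.

Lemma enormN u : enorm (- u) = enorm u.
Proof. by rewrite !enormE dotNl dotNr opprK. Qed.

Lemma ler_enormD u v : enorm (u + v) <= enorm u + enorm v.
Proof.
rewrite -(ler_pXn2r (_ : 0 < 2)%N) ?nnegrE ?addr_ge0 ?enorm_ge0//.
rewrite sqrrD !sqr_enorm !(dotDl, dotDr) (dotC v u).
have := le_trans (ler_norm _) (norm_dot_le u v); lra.
Qed.

Lemma norm_coord_le_enorm u i : `|u 0 i| <= enorm u.
Proof.
rewrite -(ler_pXn2r (_ : 0 < 2)%N) ?nnegrE ?enorm_ge0//.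
rewrite real_normK ?num_real// sqr_enorm /dot (bigD1 i)//= -expr2 lerDl.
by apply: sumr_ge0 => j _; rewrite -expr2 sqr_ge0.
Qed.

End Dot.

Section Orthonormal.
Context {R : realType} {n : nat}.
Implicit Types (m : nat) (o : nat -> 'rV[R]_n).

(** Families are indexed by [nat] and only the first [m] entries matter, so a family can be
    lengthened without changing its type. *)
Definition orthonormal m o : Prop :=
  forall i j, (i < m)%N -> (j < m)%N -> dot (o i) (o j) = (i == j)%:R.

(** The map sending a vector to its inner products with the first [m] vectors has rank at most [m],
    so its kernel meets [V] nontrivially; normalise a nonzero vector of the intersection. *)
Lemma exists_unit_orthogonal m o (V : {vspace 'rV[R]_n}) : (m < \dim V)%N ->
  exists2 e, e \in V & dot e e = 1 /\ forall i, (i < m)%N -> dot e (o i) = 0.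
Proof.
move=> mV.
pose A : 'M[R]_(n, m) := (\matrix_(i < m) o i)^T.
pose f : 'Hom('rV[R]_n, 'rV[R]_m) := linfun (mulmxr A).
have fE u (i : 'I_m) : f u 0 i = dot u (o i).
  by rewrite lfunE /= mxE; apply: eq_bigr => j _; rewrite !mxE.
have ker0 : (0 < \dim (V :&: lker f))%N.
  have := limg_ker_dim f V; have := dimvS (subvf (f @: V)).
  rewrite dimvf => h1 h2; move: h1; rewrite [dim _]mul1n => h1.
  by rewrite lt0n; apply: contraTneq mV => z; rewrite -h2 z add0n -leqNgt.
have e0 : vpick (V :&: lker f)%VS != 0.
  by rewrite vpick0 -dimv_eq0 -lt0n.
have := memv_pick (V :&: lker f)%VS; set e := vpick _ in e0 *.
rewrite memv_cap memv_ker => /andP[eV /eqP fe].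
have ee : 0 < dot e e by rewrite dot_gt0.
exists ((enorm e)^-1 *: e); first exact: memvZ.
split.
  rewrite dotZl dotZr mulrA -expr2 -sqr_enorm -exprMn mulVf ?expr1n//.
  by rewrite gt_eqF// enormE sqrtr_gt0.
move=> i im; rewrite dotZl.
by have := fE e (Ordinal im); rewrite fe mxE /= => <-; rewrite mulr0.
Qed.

Lemma orthonormal_upd m o e : orthonormal m o -> dot e e = 1 ->
  (forall i, (i < m)%N -> dot e (o i) = 0) ->
  orthonormal m.+1 (fun i => if i == m then e else o i).
Proof.
move=> oo ee eo i j; rewrite !ltnS => im jm.
case: (eqVneq i m) => [->|i_m]; case: (eqVneq j m) => [jE|j_m].
- by rewrite ee.
- by rewrite eo ?ltn_neqAle ?j_m.
- by rewrite jE (negbTE i_m) dotC eo ?ltn_neqAle ?i_m.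
- by rewrite oo ?ltn_neqAle ?i_m ?j_m.
Qed.

Lemma exists_orthonormal_in (V : {vspace 'rV[R]_n}) m : (m <= \dim V)%N ->
  exists2 o, orthonormal m o & forall i, (i < m)%N -> o i \in V.
Proof.
elim: m => [_|m IH mV]; first by exists (fun _ => 0).
case: (IH (ltnW mV)) => o oo oV.
have [e eV [ee eo]] := exists_unit_orthogonal o mV.
exists (fun i => if i == m then e else o i); first exact: orthonormal_upd.
move=> i; rewrite ltnS; case: eqVneq => [->//|im il].
by rewrite oV// ltn_neqAle im.
Qed.

Lemma orthonormal_complete m o : orthonormal m o -> (m <= n)%N ->
  exists2 o', orthonormal n o' & forall i, (i < m)%N -> o' i = o i.
Proof.
move=> + mn; have [k nk] : exists k, n = (m + k)%N.
  by exists (n - m)%N; rewrite subnKC.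
elim: k m o nk {mn} => [|k IH] m o nk oo.
  by move: nk; rewrite addn0 => nk; exists o; rewrite ?nk.
have mn : (m < \dim {:'rV[R]_n})%N.
  by rewrite dimvf [dim _]mul1n nk addnS ltnS leq_addr.
have [e _ [ee eo]] := exists_unit_orthogonal o mn.
have [|o' o'o o'E] := IH m.+1 _ _ (orthonormal_upd oo ee eo).
  by rewrite nk addSnnS.
exists o' => // i im; rewrite o'E ?(ltnW im)//.
  by rewrite ltn_eqF.
by rewrite ltnS ltnW.
Qed.

End Orthonormal.

Section Hadamard.
Context {R : realType}.

Definition psd n (S : 'M[R]_n) :=
  S^T = S /\ forall v : 'rV[R]_n, 0 <= (v *m S *m v^T) 0 0.

Lemma quadform_delta n (S : 'M[R]_n) i :
  ((delta_mx 0 i : 'rV_n) *m S *m (delta_mx 0 i : 'rV_n)^T) 0 0 = S i i.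
Proof. by rewrite -rowE trmx_delta -colE !mxE. Qed.

Lemma psd_diag_ge0 n (S : 'M[R]_n) i : psd S -> 0 <= S i i.
Proof. by move=> [_ h]; have := h (delta_mx 0 i); rewrite quadform_delta. Qed.

(** One step of block elimination and induction. With corner entry [al > 0], [det S = al * det T]
    for the Schur complement [T = D - b^T b / al]; it is again positive semidefinite, and its
    diagonal is at most that of [D]. If the corner entry is [0], positivity kills the whole first
    row and the determinant vanishes. *)
Lemma psd_det_le_prod_diag n (S : 'M[R]_n) : psd S -> \det S <= \prod_i S i i.
Proof.
elim: n S => [|n IH] S pS; first by rewrite det_mx00 big_ord0.
change 'M[R]_(1 + n) in S.
have a0 := psd_diag_ge0 ord0 pS.
have diag_ge0 : 0 <= \prod_i S i i by apply: prodr_ge0 => i _; exact: psd_diag_ge0.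
have [sym pos] := pS.
have [aE|a_neq0] := eqVneq (S ord0 ord0) 0.
  suff row0 : row ord0 S = 0.
    rewrite (expand_det_row _ ord0) big1// => j _.
    by have /rowP/(_ j) := row0; rewrite !mxE => ->; rewrite mul0r.
  apply/rowP => j; rewrite !mxE; apply/eqP/negPn/negP => b0.
  have sij : S j ord0 = S ord0 j by have /matrixP/(_ ord0 j) := sym; rewrite mxE.
  (* Chosen so that the form at [x e_0 + e_j], which is [2 x S_0j + S_jj] because the corner is
     zero, equals [-1]. *)
  pose x := - (S j j + 1) / (S ord0 j *+ 2).
  have := pos (x *: delta_mx 0 ord0 + delta_mx 0 j).
  rewrite linearD linearZ /= !(mulmxDl, mulmxDr) -!scalemxAl -!scalemxAr.
  rewrite -!rowE !trmx_delta -!colE !mxE aE sij !mulr0.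
  rewrite (_ : _ + _ = - 1); first by lra.
  by rewrite /x; field.
have a_gt0 : 0 < S ord0 ord0 by rewrite lt_neqAle eq_sym a_neq0.
pose a := ulsubmx S; pose b := ursubmx S; pose D := drsubmx S.
have SE : S = block_mx a b b^T D.
  by rewrite /b trmx_ursub sym -[LHS]submxK.
have aE : a = (S ord0 ord0)%:M.
  rewrite [a]mx11_scalar; congr (_%:M); rewrite !mxE.
  by congr (S _ _); apply/val_inj.
set al := S ord0 ord0 in a_gt0 a_neq0 aE *.
pose T := D - al^-1 *: (b^T *m b).
pose L : 'M[R]_(1 + n) := block_mx 1%:M (- al^-1 *: b) 0 1%:M.
have SL : S *m L = block_mx a 0 b^T T.
  rewrite {1}SE /L mulmx_block !mulmx0 !mulmx1 !addr0 aE.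
  rewrite -scalemxAr mul_scalar_mx scalerA mulNr mulVf// scaleN1r addNr.
  by rewrite -scalemxAr scaleNr addrC.
have detE : \det S = al * \det T.
  have := congr1 determinant SL; rewrite det_mulmx det_ublock det_lblock !det1.
  by rewrite !mulr1 aE det_scalar1.
have LSL : L^T *m S *m L = block_mx a 0 0 T.
  rewrite -mulmxA SL /L tr_block_mx !trmx1 trmx0 mulmx_block.
  rewrite !mul1mx !mul0mx !mulmx0 !addr0 !add0r; congr block_mx.
  rewrite linearZ /= aE -scalemxAl mul_mx_scalar scalerA.
  by rewrite mulNr mulVf// scaleN1r addNr.
have pT : psd T.
  split.
    rewrite /T linearB linearZ /= trmx_mul trmxK; congr (_ - _).
    by rewrite /D trmx_drsub sym.
  move=> w; have := pos (row_mx 0 w *m L^T).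
  rewrite trmx_mul trmxK !mulmxA -(mulmxA _ L^T) -(mulmxA _ _ L) LSL.
  rewrite tr_row_mx trmx0 mul_row_block mul_row_col.
  by rewrite !mul0mx !mulmx0 !add0r.
rewrite detE big_ord_recl ler_pM2l//.
apply: le_trans (IH _ pT) _; apply: ler_prod => i _.
rewrite psd_diag_ge0//=.
rewrite (_ : S (lift ord0 i) (lift ord0 i) = D i i); last first.
  by rewrite !mxE; congr (S _ _); apply/val_inj.
rewrite [T]lock !mxE -lock /T !mxE gerBl mulr_ge0 ?invr_ge0 ?(ltW a_gt0)//.
by apply: sumr_ge0 => j _; rewrite !mxE -expr2 sqr_ge0.
Qed.

(** Conjugation by the orthogonal matrix with rows [o i] preserves the determinant and puts the
    quadratic forms at the [o i] on the diagonal. *)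
Lemma psd_det_le_prod n (S : 'M[R]_n) (o : nat -> 'rV[R]_n) (c : 'I_n -> R) :
  psd S -> orthonormal n o ->
  (forall i : 'I_n, (o i *m S *m (o i)^T) 0 0 <= c i) ->
  \det S <= \prod_i c i.
Proof.
move=> [sym pos] oo hc.
pose O : 'M[R]_n := \matrix_(i < n) o i.
have OO : O *m O^T = 1%:M.
  apply/matrixP => i j; rewrite !mxE -[RHS](oo i j (ltn_ord i) (ltn_ord j)).
  by apply: eq_bigr => l _; rewrite !mxE.
have -> : \det S = \det (O *m S *m O^T).
  rewrite !det_mulmx mulrAC -det_mulmx OO det1 mul1r //.
have pOS : psd (O *m S *m O^T).
  split; first by rewrite !trmx_mul trmxK sym mulmxA.
  by move=> v; have := pos (v *m O); rewrite trmx_mul !mulmxA.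
apply: le_trans (psd_det_le_prod_diag pOS) _; apply: ler_prod => i _.
rewrite psd_diag_ge0//= -quadform_delta.
pose e : 'rV[R]_n := delta_mx 0 i.
rewrite -/e (_ : e *m (O *m S *m O^T) *m e^T = e *m O *m S *m (e *m O)^T).
  by rewrite -rowE rowK hc.
by rewrite trmx_mul !mulmxA.
Qed.

End Hadamard.

(** * Second differences and C2 functions *)

Section LineCalculus.
Context {R : realType}.

Lemma is_derive_dist_le (g : R -> R) (x l : R) : is_derive x 1 g l ->
  forall e, 0 < e -> exists2 r, 0 < r &
    forall s, `|s| < r -> `|g (x + s) - g x - s * l| <= e * `|s|.
Proof.
move=> [dg gl] e e0; rewrite -gl.
have /cvgrPdist_le/(_ e e0) : (fun h => h^-1 *: ((g \o shift x) (h *: 1) - g x))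
    @ 0^' --> 'D_1 g x by exact: dg.
rewrite /= /dnbhs /within /= => /nbhs_ballP[r /= r0 hr]; exists r => // s sr.
have [->|s0] := eqVneq s 0; first by rewrite addr0 subrr mul0r subrr !normr0 mulr0.
have := hr s; rewrite /ball /= sub0r normrN => /(_ sr s0).
rewrite [s *: 1]mulr1 [s^-1 *: _]mulrC (addrC s) => h.
rewrite (_ : _ - _ - _ = - (('D_1 g x - (g (x + s) - g x) / s) * s)); last by field.
by rewrite normrN normrM ler_wpM2r.
Qed.

Lemma dist_le_is_derive (V : normedModType R) (f : V -> R) x v l :
  (forall e, 0 < e -> exists2 r, 0 < r &
    forall s, `|s| < r -> `|f (x + s *: v) - f x - s * l| <= e * `|s|) ->
  is_derive x v f l.
Proof.
move=> h.
have dl : (fun h => h^-1 *: ((f \o shift x) (h *: v) - f x)) @ 0^' --> l.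
  apply/cvgrPdist_le => e e0; have [r r0 hr] := h e e0.
  rewrite /= /dnbhs /within /=; apply/nbhs_ballP; exists r => // s.
  rewrite /ball /= sub0r normrN => sr s0; have := hr s sr.
  rewrite [s^-1 *: _]mulrC (addrC (s *: v)) => h'.
  rewrite -(ler_pM2r (_ : 0 < `|s|)) ?normr_gt0// -normrM.
  rewrite (_ : _ * s = - (f (x + s *: v) - f x - s * l)); last by field.
  by rewrite normrN.
by apply: DeriveDef; [apply/cvg_ex; exists l | exact/cvg_lim].
Qed.

Lemma is_derive_line (V : normedModType R) (f : V -> R) y v s l :
  is_derive (y + s *: v) v f l -> is_derive s 1 (fun r : R => f (y + r *: v)) l.
Proof.
move=> [df fl].
have E : (fun h : R => h^-1 *: (((fun r : R => f (y + r *: v)) \o shift s) (h *: 1)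
      - f (y + s *: v)))
    = (fun h => h^-1 *: ((f \o shift (y + s *: v)) (h *: v) - f (y + s *: v))).
  apply/funext => h /=; rewrite [h *: 1]mulr1 scalerDl.
  by rewrite addrCA.
by apply: DeriveDef; rewrite /derivable /derive E.
Qed.

Lemma MVT_unit (g g1 : R -> R) :
  (forall s : R, s \in `[0, 1] -> is_derive s 1 g (g1 s)) ->
  exists2 c, c \in `[0, 1] & g 1 - g 0 = g1 c.
Proof.
move=> dg; have le01 : (0 : R) <= 1 by rewrite ler01.
have dg' : forall s : R, s \in `]0, 1[ -> is_derive s 1 g (g1 s).
  by move=> s /subset_itv_oo_cc; exact: dg.
have [|c c01 E] := @MVT_segment R g g1 0 1 le01 dg'.
  by apply: derivable_within_continuous => s /dg[].
by exists c; rewrite // E subr0 mulr1.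
Qed.

Lemma MVT_origin (g g1 : R -> R) (h : R) :
  (forall s : R, `|s| <= `|h| -> is_derive s 1 g (g1 s)) ->
  exists2 t, `|t| <= `|h| & g h - g 0 = h * g1 t.
Proof.
move=> dg.
have cont a b : (forall s, s \in `[a, b] -> `|s| <= `|h|) ->
    {within `[a, b], continuous g}.
  by move=> hab; apply: derivable_within_continuous => s /hab /dg [].
have [h0|h0] := leP 0 h.
  have hs s : s \in `[0, h] -> `|s| <= `|h|.
    by rewrite in_itv/= => /andP[? ?]; rewrite !ger0_norm.
  have [||t ht ->] := @MVT_segment _ g g1 0 h h0.
  - by move=> s /subset_itv_oo_cc /hs /dg.
  - exact: cont.
  by exists t; [exact: hs|rewrite subr0 mulrC].
have hs s : s \in `[h, 0] -> `|s| <= `|h|.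
  by rewrite in_itv/= => /andP[? ?]; rewrite !ler0_norm ?lerN2// ltW.
have [||t ht] := @MVT_segment _ g g1 h 0 (ltW h0).
- by move=> s /subset_itv_oo_cc /hs /dg.
- exact: cont.
by rewrite sub0r => E; exists t; [exact: hs|rewrite -opprB E; ring].
Qed.

(** If [q > c], then [G s = g s + g (- s) - c s^2] has derivative close to [2 (q - c) s > 0] for
    small [s > 0], so it increases strictly from [G 0], against the hypothesis. The tolerance
    [(q - c) / 2] on each of [g1 s] and [g1 (- s)] leaves a derivative of at least [(q - c) s]. *)
Lemma second_difference_le (g g1 : R -> R) (q c r : R) : 0 < r ->
  (forall s : R, `|s| < r -> is_derive s 1 g (g1 s)) -> is_derive (0 : R) 1 g1 q ->
  (forall s : R, 0 < s -> s < r -> g s + g (- s) - g 0 *+ 2 <= c * s ^+ 2) ->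
  q <= c.
Proof.
move=> r0 dg dg1 hc; rewrite leNgt; apply/negP => cq.
have e0 : 0 < (q - c) / 2 by rewrite divr_gt0// subr_gt0.
have [r1 r10 h1] := is_derive_dist_le dg1 e0.
pose h := Num.min r r1 / 2.
have m0 : 0 < Num.min r r1 by rewrite lt_min r0.
have h0 : 0 < h by rewrite divr_gt0.
have hm : h < Num.min r r1 by rewrite /h; lra.
have [hr hr1] : h < r /\ h < r1 by apply/andP; rewrite -lt_min.
pose G s := g s + g (- s) - c * s ^+ 2.
pose G1 s := g1 s - g1 (- s) - c * (s *+ 2).
have dG (s : R) : `|s| < r -> is_derive s 1 G (G1 s).
  move=> sr; have d1 := dg s sr; have d2 : is_derive (- s) 1 g (g1 (- s)).
    by apply: dg; rewrite normrN.
  have d3 : is_derive s 1 (g \o -%R) (g1 (- s) * -1) by exact: is_derive1_comp.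
  have -> : G = (g + (g \o -%R)) - c *: (fun s => s) ^+ 2 by [].
  by apply: is_derive_eq; rewrite /G1 /GRing.scale /=; ring.
have [||t] := @MVT _ G G1 0 h h0.
- move=> s; rewrite in_itv/= => /andP[s0 sh]; apply: dG.
  by rewrite gtr0_norm// (lt_trans sh).
- apply: derivable_within_continuous => s; rewrite in_itv/= => /andP[s0 sh].
  by have [] := dG s _; rewrite // ger0_norm// (le_lt_trans sh).
rewrite in_itv/= subr0 => /andP[t0 th] E.
have : G h <= G 0.
  by have := hc h h0 hr; rewrite /G oppr0 expr0n/= mulr0; lra.
rewrite -subr_le0 E pmulr_lle0//; apply/negP; rewrite -ltNge /G1.
have tr1 : `|t| < r1 by rewrite gtr0_norm// (lt_trans th).
have := h1 t tr1; have := h1 (- t); rewrite normrN => /(_ tr1).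
rewrite !add0r !(gtr0_norm t0) !ler_norml => /andP[a1 a2] /andP[b1 b2].
have : 0 < (q - c) * t by rewrite mulr_gt0// subr_gt0.
lra.
Qed.

Lemma second_difference_ge (g g1 : R -> R) (q c r : R) : 0 < r ->
  (forall s : R, `|s| < r -> is_derive s 1 g (g1 s)) -> is_derive (0 : R) 1 g1 q ->
  (forall s : R, 0 < s -> s < r -> c * s ^+ 2 <= g s + g (- s) - g 0 *+ 2) ->
  c <= q.
Proof.
move=> r0 dg dg1 hc; rewrite -lerN2.
apply: (@second_difference_le (- g) (- g1) _ _ r r0).
- by move=> s /dg d; apply: is_derive_eq.
- by move=> s s0 sr; have := hc s s0 sr; rewrite !fctE; lra.
Qed.

End LineCalculus.

Section Multivariate.
Context {R : realType} {n : nat}.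
Implicit Types (f : 'rV[R]_n -> R) (x v e : 'rV[R]_n) (Omega : set 'rV[R]_n).

Lemma nbhs_coordP x (P : set 'rV[R]_n) : nbhs x P ->
  exists2 r : R, 0 < r &
    forall y : 'rV[R]_n, (forall i, `|y 0 i - x 0 i| < r) -> P y.
Proof.
move=> /nbhs_ballP[r /= r0 h]; exists r => // y yr.
apply: h; split=> // i j; rewrite (ord1 i) /ball /= distrC; exact: yr.
Qed.

Lemma nbhs_line x v (P : set 'rV[R]_n) : nbhs x P ->
  exists2 r : R, 0 < r & forall s : R, `|s| < r -> P (x + s *: v).
Proof.
move=> /nbhs_coordP[r r0 h].
(* [N] dominates every coordinate of [v]; the summand 1 keeps it positive when [v = 0]. *)
pose N := 1 + \sum_i `|v 0 i|.
have N0 : 0 < N by rewrite ltr_wpDr// sumr_ge0.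
exists (r / N); first exact: divr_gt0.
move=> s; rewrite ltr_pdivlMr// => sN; apply: h => i.
rewrite !mxE (addrC (x 0 i)) addrK normrM (le_lt_trans _ sN)// ler_wpM2l//.
by rewrite /N (bigD1 i)//= addrCA lerDl addr_ge0// sumr_ge0.
Qed.

Definition C1_on Omega f := forall x, Omega x -> forall i : 'I_n,
  derivable f x (delta_mx 0 i : 'rV[R]_n) /\ {for x, continuous (partial i f)}.

(** [C2_on] speaks of derivatives along the axes only, while the barrier is compared along arbitrary
    directions. The coordinates of [h] are switched on one at a time, by induction on the number [m]
    of leading coordinates allowed to be nonzero; each step is a mean value theorem on a box where
    every partial derivative stays within [eps] of its value at [x]. *)
Lemma C1_taylor Omega f x : open Omega -> C1_on Omega f -> Omega x ->
  forall eps : R, 0 < eps -> exists2 r : R, 0 < r &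
    forall h : 'rV[R]_n, (forall i, `|h 0 i| < r) ->
      `|f (x + h) - f x - dot h (grad f x)| <= eps * \sum_i `|h 0 i|.
Proof.
move=> oO fC1 Ox eps eps0.
have : \forall y \near x, Omega y /\ forall i, `|partial i f x - partial i f y| <= eps.
  apply: filterI; first exact: open_nbhs_nbhs.
  refine (@filter_forall _ 'I_n
    (fun i => [set y | `|partial i f x - partial i f y| <= eps]) (nbhs x) _ _) => i.
  by have [_ /cvgrPdist_le/(_ eps eps0)] := fC1 x Ox i.
move=> /nbhs_coordP[r r0 hr]; exists r => // h.
suff H m : (m <= n)%N -> forall h : 'rV[R]_n, (forall i, `|h 0 i| < r) ->
    (forall i : 'I_n, (m <= i)%N -> h 0 i = 0) ->
    `|f (x + h) - f x - dot h (grad f x)| <= eps * \sum_i `|h 0 i|.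
  by move=> hi; apply: (H n) => // i; rewrite leqNgt ltn_ord.
elim: m => [_|m IH mn] {}h hi h0.
  have -> : h = 0 by apply/rowP => i; rewrite h0// mxE.
  rewrite addr0 subrr dot0l subrr normr0 mulr_ge0 ?(ltW eps0)//.
  exact: sumr_ge0.
pose j := Ordinal mn; pose a := h 0 j.
pose h' : 'rV[R]_n := h - a *: delta_mx 0 j.
have h'j : h' 0 j = 0 by rewrite !mxE !eqxx mulr1 subrr.
have h'i i : i != j -> h' 0 i = h 0 i.
  by move=> ij; rewrite !mxE eqxx (negbTE ij) mulr0 subr0.
have hE : h = h' + a *: delta_mx 0 j by rewrite subrK.
have {}IH : `|f (x + h') - f x - dot h' (grad f x)| <= eps * \sum_i `|h' 0 i|.
  apply: IH; first exact: ltnW.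
    move=> i; have [->|ij] := eqVneq i j; first by rewrite h'j normr0.
    by rewrite h'i.
  move=> i; rewrite leq_eqVlt => /orP[/eqP mi|mi].
    by rewrite (_ : i = j)//; exact/val_inj.
  by rewrite h'i ?h0// -(inj_eq val_inj)/= gtn_eqF.
have in_box (s : R) : `|s| <= `|a| -> forall i,
    `|(x + h' + s *: delta_mx 0 j) 0 i - x 0 i| < r.
  move=> sa i; rewrite -addrA mxE (addrC (x 0 i)) addrK mxE.
  have [->|ij] := eqVneq i j.
    by rewrite h'j add0r !mxE !eqxx mulr1 (le_lt_trans sa)// hi.
  by rewrite h'i// !mxE eqxx (negbTE ij) mulr0 addr0 hi.
have [|t ta] := @MVT_origin _ (fun s : R => f (x + h' + s *: delta_mx 0 j))
    (fun s => partial j f (x + h' + s *: delta_mx 0 j)) a.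
  move=> s sa; apply: is_derive_line.
  have [Oy _] := hr _ (in_box s sa).
  by apply: derivableP; have [] := fC1 _ Oy j.
rewrite scale0r addr0 -addrA -hE => E.
have [_ /(_ j) dj] := hr _ (in_box t ta).
have dotE : dot h (grad f x) = dot h' (grad f x) + a * partial j f x.
  rewrite hE dotDl dotZl; congr (_ + _ * _).
  rewrite /dot (bigD1 j)//= big1 ?addr0 => [|i ij].
    by rewrite !mxE !eqxx mul1r.
  by rewrite !mxE eqxx (negbTE ij) mul0r.
have sumE : \sum_i `|h 0 i| = \sum_i `|h' 0 i| + `|a|.
  rewrite (bigD1 j)//= [in RHS](bigD1 j)//= h'j normr0 add0r addrC.
  by congr (_ + _); apply: eq_bigr => i ij; rewrite h'i.
have -> : f (x + h) - f x - dot h (grad f x) =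
    (f (x + h') - f x - dot h' (grad f x)) +
    a * (partial j f (x + h' + t *: delta_mx 0 j) - partial j f x).
  rewrite dotE -[f (x + h)](subrK (f (x + h'))) E; ring.
rewrite sumE [leRHS]mulrDr (le_trans (ler_normD _ _))// lerD//.
by rewrite normrM mulrC ler_wpM2r// distrC.
Qed.

Lemma C1_is_derive Omega f x v : open Omega -> C1_on Omega f -> Omega x ->
  is_derive x v f (dot v (grad f x)).
Proof.
move=> oO fC1 Ox; apply: dist_le_is_derive => e e0.
pose N := 1 + \sum_i `|v 0 i|.
have N0 : 0 < N by rewrite ltr_wpDr// sumr_ge0.
have [r r0 hr] := C1_taylor oO fC1 Ox (divr_gt0 e0 N0).
exists (r / N); first exact: divr_gt0.
move=> s; rewrite ltr_pdivlMr// => sN.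
have := hr (s *: v); rewrite dotZl => /(_ _)/le_trans; apply.
  move=> i; rewrite !mxE normrM (le_lt_trans _ sN)// ler_wpM2l//.
  by rewrite /N (bigD1 i)//= addrCA lerDl addr_ge0// sumr_ge0.
rewrite -mulrA ler_pM2l// mulrC ler_pdivrMr//.
rewrite (eq_bigr (fun i => `|s| * `|v 0 i|)) => [|i _]; last by rewrite mxE normrM.
by rewrite -mulr_sumr ler_wpM2l// /N lerDr.
Qed.

Lemma C2_C1 Omega f : C2_on Omega f -> C1_on Omega f.
Proof. by move=> h x /h[_ +] i => /(_ i)[]. Qed.

Lemma C2_C1_partial Omega f i : C2_on Omega f -> C1_on Omega (partial i f).
Proof. by move=> h x /h[_ +] j => /(_ i)[_ _ +] => /(_ j). Qed.

Lemma C2_is_derive_line Omega f x v (s : R) : open Omega -> C2_on Omega f ->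
  Omega (x + s *: v) ->
  is_derive s 1 (fun r : R => f (x + r *: v)) (dot v (grad f (x + s *: v))).
Proof.
by move=> oO /C2_C1 fC1 Ox; apply: is_derive_line; exact: C1_is_derive Ox.
Qed.

Lemma quadform_hessian f x v :
  (v *m hessian f x *m v^T) 0 0 =
  \sum_i v 0 i * dot v (grad (partial i f) x).
Proof.
rewrite mxE; apply: eq_bigr => i _; rewrite !mxE mulrC; congr (_ * _).
by apply: eq_bigr => j _; rewrite !mxE.
Qed.

Lemma C2_is_derive_grad_line Omega f x v : open Omega -> C2_on Omega f ->
  Omega x ->
  is_derive (0 : R) 1 (fun r : R => dot v (grad f (x + r *: v)))
    ((v *m hessian f x *m v^T) 0 0).
Proof.
move=> oO fC2 Ox; rewrite quadform_hessian.
have dl i : is_derive (0 : R) 1 (fun r : R => v 0 i * partial i f (x + r *: v))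
    (v 0 i * dot v (grad (partial i f) x)).
  have d : is_derive (0 : R) 1 (fun r : R => partial i f (x + r *: v))
      (dot v (grad (partial i f) x)).
    apply: is_derive_line; rewrite scale0r addr0.
    exact: C1_is_derive oO (C2_C1_partial i fC2) Ox.
  exact: (is_deriveZ (v 0 i)).
rewrite (_ : (fun r : R => _) =
    \sum_(i < n) (fun r : R => v 0 i * partial i f (x + r *: v))).
  exact: is_derive_sum.
apply/funext => r; rewrite fct_sumE.
by apply: eq_bigr => i _; rewrite mxE.
Qed.

(** Converts a comparison of second differences at the maximum into a Hessian bound, so that no
    smoothness of the barrier is required. *)
Lemma quadform_hessian_le Omega f x v (c r : R) : open Omega -> C2_on Omega f ->
  Omega x -> 0 < r ->
  (forall s : R, 0 < s -> s < r ->
    f (x + s *: v) + f (x - s *: v) - f x *+ 2 <= c * s ^+ 2) ->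
  (v *m hessian f x *m v^T) 0 0 <= c.
Proof.
move=> oO fC2 Ox r0 h.
have [r1 r10 h1] := nbhs_line v (open_nbhs_nbhs (conj oO Ox)).
apply: (@second_difference_le _ _ _ _ _ (Num.min r r1) _ _
  (C2_is_derive_grad_line v oO fC2 Ox)).
- by rewrite lt_min r0.
- move=> s; rewrite lt_min => /andP[_ sr1].
  by apply: C2_is_derive_line (h1 _ sr1).
- move=> s s0; rewrite lt_min => /andP[sr _].
  by rewrite scale0r addr0 scaleNr h.
Qed.

Lemma quadform_hessian_ge Omega f x v (c r : R) : open Omega -> C2_on Omega f ->
  Omega x -> 0 < r ->
  (forall s : R, 0 < s -> s < r ->
    c * s ^+ 2 <= f (x + s *: v) + f (x - s *: v) - f x *+ 2) ->
  c <= (v *m hessian f x *m v^T) 0 0.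
Proof.
move=> oO fC2 Ox r0 h.
have [r1 r10 h1] := nbhs_line v (open_nbhs_nbhs (conj oO Ox)).
apply: (@second_difference_ge _ _ _ _ _ (Num.min r r1) _ _
  (C2_is_derive_grad_line v oO fC2 Ox)).
- by rewrite lt_min r0.
- move=> s; rewrite lt_min => /andP[_ sr1].
  by apply: C2_is_derive_line (h1 _ sr1).
- move=> s s0; rewrite lt_min => /andP[sr _].
  by rewrite scale0r addr0 scaleNr h.
Qed.

(* Both mixed partials are limits of the same mixed second difference. *)
Lemma hessian_sym Omega f x : open Omega -> C2_on Omega f -> Omega x ->
  (hessian f x)^T = hessian f x.
Proof.
move=> oO fC2 Ox; apply/matrixP => i j; rewrite !mxE.
pose D (i j : 'I_n) (s t : R) : 'rV[R]_n := s *: delta_mx 0 i + t *: delta_mx 0 j.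
have near_box : forall eps : R, 0 < eps -> exists2 r : R, 0 < r &
    forall s t : R, `|s| <= r -> `|t| <= r -> Omega (x + D i j s t) /\
      forall k l : 'I_n, `|partial k (partial l f) x -
        partial k (partial l f) (x + D i j s t)| < eps.
  move=> eps eps0.
  have : \forall y \near x, Omega y /\ forall k l : 'I_n,
      `|partial k (partial l f) x - partial k (partial l f) y| < eps.
    apply: filterI; first exact: open_nbhs_nbhs.
    refine (@filter_forall _ 'I_n (fun k => [set y | forall l : 'I_n,
      `|partial k (partial l f) x - partial k (partial l f) y| < eps])
      (nbhs x) _ _) => k.
    refine (@filter_forall _ 'I_n (fun l => [set y |
      `|partial k (partial l f) x - partial k (partial l f) y| < eps])
      (nbhs x) _ _) => l.
    have [_ /(_ l)[_ _ /(_ k)[_ /cvgrPdist_lt]]] := fC2 x Ox.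
    exact.
  move=> /nbhs_coordP[r r0 hr]; exists (r / 3); first exact: divr_gt0.
  move=> s t sr tr; apply: hr => k.
  rewrite mxE (addrC (x 0 k)) addrK !mxE !eqxx /=.
  have : `|s * (k == i)%:R| <= r / 3.
    by case: (k == i); rewrite ?mulr1// mulr0 normr0 ltW// divr_gt0.
  have : `|t * (k == j)%:R| <= r / 3.
    by case: (k == j); rewrite ?mulr1// mulr0 normr0 ltW// divr_gt0.
  move=> h1 h2; apply: (le_lt_trans (ler_normD _ _)); lra.
have mixed (r : R) (k l : 'I_n) : 0 < r ->
    (forall s t : R, `|s| <= r -> `|t| <= r -> Omega (x + D k l s t)) ->
    exists s t : R, [/\ `|s| <= r, `|t| <= r &
      f (x + D k l r r) - f (x + D k l r 0) - f (x + D k l 0 r) + f (x + D k l 0 0)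
      = r ^+ 2 * partial l (partial k f) (x + D k l s t)].
  move=> r0 hO.
  have rr : `|r| = r by rewrite gtr0_norm.
  have DE s t : x + D k l s t = (x + t *: delta_mx 0 l) + s *: delta_mx 0 k.
    by rewrite addrA addrAC.
  have DE' s t : x + D k l s t = (x + s *: delta_mx 0 k) + t *: delta_mx 0 l.
    by rewrite addrA.
  have [|s sr E] := @MVT_origin _
      (fun s => f (x + D k l s r) - f (x + D k l s 0))
      (fun s => partial k f (x + D k l s r) - partial k f (x + D k l s 0)) r.
    move=> s; rewrite rr => sr.
    have d t : `|t| <= r ->
        is_derive s 1 (fun s => f (x + D k l s t)) (partial k f (x + D k l s t)).
      move=> tr; under eq_fun do rewrite DE; rewrite DE; apply: is_derive_line.
      apply: derivableP; have := hO s t sr tr; rewrite DE => Oy.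
      by have [] := C2_C1 fC2 Oy k.
    have dr := d r; have d0 := d 0; rewrite rr lexx in dr; rewrite normr0 in d0.
    have := dr isT; have := d0 (ltW r0) => {}d0 {}dr.
    exact: is_deriveB.
  rewrite rr in sr.
  have [|t tr E'] := @MVT_origin _
      (fun t => partial k f (x + D k l s t))
      (fun t => partial l (partial k f) (x + D k l s t)) r.
    move=> t; rewrite rr => tr.
    under eq_fun do rewrite DE'; rewrite DE'; apply: is_derive_line.
    apply: derivableP; have := hO s t sr tr; rewrite DE' => Oy.
    by have [] := C2_C1_partial k fC2 Oy l.
  rewrite rr in tr; exists s, t; split=> //.
  by rewrite expr2 -mulrA -E' -E; ring.
apply/eqP; rewrite -subr_eq0; apply/negPn/negP => neq.
have eps0 : 0 < `|partial j (partial i f) x - partial i (partial j f) x| / 2.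
  by rewrite divr_gt0// normr_gt0.
have [r r0 hr] := near_box _ eps0.
have [s [t [sr tr E]]] := mixed r i j r0 (fun s t sr tr => (hr s t sr tr).1).
have swap s' t' : D j i s' t' = D i j t' s' by rewrite /D addrC.
have [|t' [s' [tr' sr' E']]] := mixed r j i r0.
  by move=> s' t' sr' tr'; rewrite swap; have [] := hr t' s' tr' sr'.
move: E'; rewrite !swap => E'.
have [_ /(_ j i)] := hr _ _ sr tr; have [_ /(_ i j)] := hr _ _ sr' tr'.
move: E E'; move: (partial j (partial i f) (x + D i j s t)) => w.
move: (partial i (partial j f) (x + D i j s' t')) => u E E' h1 h2.
have {}E : w = u.
  apply: (@mulfI _ (r ^+ 2)); first by rewrite expf_neq0// gt_eqF.
  by rewrite -E -E'; congr (_ + _); rewrite addrAC.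
have := ler_distD u (partial j (partial i f) x) (partial i (partial j f) x).
rewrite leNgt => /negP; apply; rewrite (distrC u); rewrite E in h2.
by apply: lt_le_trans (ltrD h2 h1) _; rewrite -splitr.
Qed.

End Multivariate.

(** * Null sets *)

Section NullSets.
Context {R : realType}.

(* Tonelli by induction on the dimension: for each value [t] of the last
   coordinate, the boxes whose last side contains [t] cover the slice at [t]. *)
Lemma box_cover_volume (n : nat) (P : nat -> bool) (a b : nat -> nat -> R)
    (p q : nat -> R) :
  (forall k i, a k i <= b k i) -> (forall i, p i <= q i) ->
  (forall x : nat -> R, (forall i, (i < n)%N -> p i <= x i <= q i) ->
    exists2 k, P k & forall i, (i < n)%N -> a k i <= x i <= b k i) ->
  ((\prod_(i < n) (q i - p i))%:E <=
   \sum_(0 <= k <oo) ((P k)%:R * \prod_(i < n) (b k i - a k i))%:E)%E.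
Proof.
move=> ab pq; elim: n P => [|n IH] P cover.
  have [k Pk _] : exists2 k, P k & forall i, (i < 0)%N -> a k i <= p i <= b k i.
    exact: cover.
  rewrite big_ord0; apply: le_trans (nneseries_lim_ge k.+1 _); last first.
    by move=> i _ _; rewrite lee_fin mulr_ge0// big_ord0.
  rewrite big_nat_recr//= Pk mul1r big_ord0 leeDr//.
  by apply: sume_ge0 => i _; rewrite lee_fin big_ord0 mulr1.
pose mu := @lebesgue_measure R; pose D : set R := `[p n, q n]%classic.
pose c k : R := (P k)%:R * \prod_(i < n) (b k i - a k i).
pose A k : set R := `[a k n, b k n]%classic.
have c0 k : 0 <= c k.
  by rewrite mulr_ge0// prodr_ge0// => i _; rewrite subr_ge0.
have mD : measurable D by exact: measurable_itv.
have mA k : measurable (A k) by exact: measurable_itv.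
have muE (x y : R) : x <= y -> mu `[x, y]%classic = (y - x)%:E.
  move=> xy; rewrite /mu lebesgue_measure_itv/= lte_fin.
  by case: ltgtP xy => // ->; rewrite subrr.
have mf k : measurable_fun D (EFin \o (\1_(A k) : R -> R)).
  by apply/measurable_EFinP; exact: measurable_indic.
have slice t : D t -> ((\prod_(i < n) (q i - p i))%:E <=
    \sum_(0 <= k <oo) ((c k)%:E * (\1_(A k) t : R)%:E))%E.
  rewrite /D /= in_itv/= => Dt.
  have := IH (fun k => P k && (a k n <= t <= b k n)).
  under eq_eseriesr => k _.
    rewrite (_ : _%:E = ((c k)%:E * (\1_(A k) t : R)%:E)%E); first over.
    rewrite -EFinM /c indicE; congr (_%:E).
    rewrite (_ : (t \in A k) = (a k n <= t <= b k n)); last first.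
      by apply/idP/idP; rewrite inE /A /= in_itv.
    by rewrite mulrAC -natrM mulnb.
  apply=> x xpq.
  have [|k Pk kx] := cover (fun i => if i == n then t else x i).
    move=> i; rewrite ltnS leq_eqVlt; case: eqVneq => [-> _|_ /= /xpq] //.
  exists k; first by rewrite Pk; have := kx n (ltnSn n); rewrite eqxx.
  move=> i i_n; have := kx i (ltnW i_n : (i < n.+1)%N).
  by rewrite ltn_eqF.
rewrite big_ord_recr/= EFinM -muE// -(integral_cst mu mD).
apply: (@le_trans _ _
    (\int[mu]_(t in D) \sum_(0 <= k <oo) ((c k)%:E * (\1_(A k) t : R)%:E))%E).
  apply: ge0_le_integral => //=.
  - move=> t _; rewrite lee_fin prodr_ge0// => i _; by rewrite subr_ge0.
  - apply: ge0_emeasurable_sum => k.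
      by move=> t _ _; rewrite mule_ge0// lee_fin.
    by move=> _; exact: (measurable_funeM _ (mf k)).
rewrite integral_nneseries//; last 2 first.
- by move=> k; exact: (measurable_funeM _ (mf k)).
- by move=> k t _; rewrite mule_ge0// lee_fin.
apply: lee_nneseries => k _.
  by move=> _; apply: integral_ge0 => t _; rewrite mule_ge0// lee_fin.
rewrite ge0_integralZl_EFin//; last exact: mf.
rewrite integral_indic//; last exact: mA.
rewrite [X in _ * X]big_ord_recr/= mulrA -/(c k) [leRHS]EFinM lee_wpmul2l//.
  by rewrite lee_fin.
rewrite -muE//; apply: le_measure; rewrite ?inE; last exact: subIsetl.
  by apply: measurableI; [exact: mA|exact: mD].
exact: mA.
Qed.

(** A nonempty open set contains a closed cube of side [r]; by [box_cover_volume] every countable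
    cover of it by boxes has total volume at least [r ^+ n], which rules out a cover of volume
    [r ^+ n / 2]. *)
Lemma open_not_null n (A : set 'rV[R]_n) : open A -> lebesgue_null A -> A = set0.
Proof.
move=> oA nA; apply/seteqP; split => // x Ax.
have [r r0 hr] := nbhs_coordP (open_nbhs_nbhs (conj oA Ax)).
(* [box_cover_volume] indexes coordinates by [nat]; the value 0 at indices from [n] on is a mere
   default, and likewise in [ext] below. *)
pose X (i : nat) : R := if insub i is Some j then x 0 j else 0.
have XE (j : 'I_n) : X j = x 0 j by rewrite /X valK.
have r20 : 0 < r / 2 by rewrite divr_gt0.
have [|a [b [ab cover]]] := nA (r ^+ n / 2).
  by rewrite divr_gt0// exprn_gt0.
pose ext (u : nat -> 'rV[R]_n) k (i : nat) : R :=
  if insub i is Some j then u k 0 j else 0.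
have extE u k (j : 'I_n) : ext u k j = u k 0 j by rewrite /ext valK.
rewrite leNgt => /negP; apply.
have := @box_cover_volume n xpredT (ext a) (ext b)
  (fun i => X i - r / 2) (fun i => X i + r / 2).
have -> : \prod_(i < n) (X i + r / 2 - (X i - r / 2)) = r ^+ n.
  rewrite (eq_bigr (fun=> r)) ?prodr_const ?card_ord// => i _; lra.
under eq_eseriesr => k _.
  rewrite mul1r (eq_bigr (fun i => b k 0 i - a k 0 i)) => [|i _].
    over.
  by rewrite !extE.
move=> h; apply: lt_le_trans (h _ _ _).
- by rewrite lte_fin gtr_pMr ?exprn_gt0// invf_lt1// ltr1n.
- by move=> k i; rewrite /ext; case: insub => // j; exact: ab.
- by move=> i; lra.
move=> y hy.
have [|k _ kx] := cover (\row_i y i).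
  apply: hr => i; rewrite mxE -XE.
  have := hy i (ltn_ord i); rewrite ltr_norml; lra.
exists k => // i i_n.
by have := kx (Ordinal i_n); rewrite mxE -!extE.
Qed.

End NullSets.

(** * The radial profile of the barrier *)

Section Primitive.
Context {R : realType}.
Implicit Types g : R -> R.

Definition primitive g (t : R) : R := \int[@lebesgue_measure R]_(r in `[0, t]) g r.

Lemma within_itv_integrable g (a b : R) : {within `[a, b], continuous g} ->
  (@lebesgue_measure R).-integrable `[a, b] (EFin \o g).
Proof. by move=> cg; exact/continuous_compact_integrable/cg/segment_compact. Qed.

(** Used in place of the fundamental theorem of calculus: the estimates on [slope] and [profile]
    below rest on increments, not on derivatives. *)
Lemma primitive_increment g (a b m M : R) :
  {within `[0, b], continuous g} -> 0 <= a -> a <= b ->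
  (forall r, a <= r -> r <= b -> m <= g r <= M) ->
  m * (b - a) <= primitive g b - primitive g a <= M * (b - a).
Proof.
move=> cg a0 ab gmM; have b0 := le_trans a0 ab.
have ig := within_itv_integrable cg.
have iab : (@lebesgue_measure R).-integrable `[a, b] (EFin \o g).
  apply: integrableS ig => //; apply: subset_itvr; by rewrite bnd_simp.
have iab' : (@lebesgue_measure R).-integrable `]a, b] (EFin \o g).
  by apply: integrableS iab => //; exact: subset_itv_oc_cc.
have -> : primitive g b - primitive g a =
    \int[@lebesgue_measure R]_(r in `[a, b]) g r.
  rewrite /primitive Rintegral_itvB ?bnd_simp//.
  by rewrite Rintegral_itv_obnd_cbnd.
have icst c : (@lebesgue_measure R).-integrable `[a, b] (EFin \o cst c).
  by apply: within_itv_integrable; apply: continuous_subspaceT; exact: cst_continuous.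
have cstE c : c * (b - a) = \int[@lebesgue_measure R]_(r in `[a, b]) (cst c) r.
  rewrite Rintegral_cst; last exact: measurable_itv.
  rewrite /= lebesgue_measure_itv/= lte_fin.
  by case: ltgtP ab => // ->; rewrite subrr.
rewrite !cstE; apply/andP; split; apply: le_Rintegral => //= r;
  by rewrite in_itv/= => /andP[ar rb]; have /andP[] := gmM r ar rb.
Qed.

Lemma primitive_continuous g (b : R) : 0 <= b -> {within `[0, b], continuous g} ->
  {within `[0, b], continuous (primitive g)}.
Proof.
move=> b0 cg; apply: parameterized_integral_continuous => //.
exact: within_itv_integrable.
Qed.

Lemma primitive0 g : primitive g 0 = 0.
Proof. by rewrite /primitive set_itv1 Rintegral_set1. Qed.

End Primitive.

Section Profile.
Context {R : realType} (j d : nat).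

(** With [j = n - d - 1] this is the integrand of [phi]. The function [F] of the barrier is a
    multiple of its double primitive [profile], evaluated at [t / gam]. *)
Definition dens (r : R) : R := r ^+ j / (r + 1) ^+ d.
Definition slope : R -> R := primitive dens.
Definition profile : R -> R := primitive slope.

Lemma dens_bounds (a c r : R) : 0 <= a -> a <= r -> r <= c ->
  a ^+ j / (c + 1) ^+ d <= dens r <= c ^+ j / (a + 1) ^+ d.
Proof.
move=> a0 ar rc; have r0 := le_trans a0 ar; have c0 := le_trans r0 rc.
have pos (x : R) : 0 <= x -> 0 < (x + 1) ^+ d.
  by move=> x0; rewrite exprn_gt0// ltr_wpDl.
rewrite /dens; apply/andP; split; apply: ler_pM;
  rewrite ?exprn_ge0 ?invr_ge0 ?(ltW (pos _ _))//;
  rewrite ?lef_pV2 ?posrE ?pos//; apply: lerXn2r;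
  by rewrite ?nnegrE ?addr_ge0 ?lerD2r.
Qed.

Lemma dens_continuous (t : R) : {within `[0, t], continuous dens}.
Proof.
apply/continuous_in_subspaceT => r; rewrite inE/= in_itv/= => /andP[r0 _].
apply: cvgM.
  exact: exprn_continuous.
apply: cvgV; first by rewrite expf_neq0// gt_eqF// ltr_wpDl.
apply: (@continuous_comp _ _ _ (fun x : R => x + 1) (fun x => x ^+ d)).
  by apply: cvgD; [exact: cvg_id|exact: cvg_cst].
exact: exprn_continuous.
Qed.

Lemma slope_increment (a b m M : R) : 0 <= a -> a <= b ->
  (forall r, a <= r -> r <= b -> m <= dens r <= M) ->
  m * (b - a) <= slope b - slope a <= M * (b - a).
Proof. exact/primitive_increment/dens_continuous. Qed.

Lemma slope0 : slope 0 = 0. Proof. exact: primitive0. Qed.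
Lemma profile0 : profile 0 = 0. Proof. exact: primitive0. Qed.

Lemma slope_le (a b : R) : 0 <= a -> a <= b -> slope a <= slope b.
Proof.
move=> a0 ab; have [|h _] := andP (@slope_increment a b 0 (b ^+ j) a0 ab _).
  move=> r ar rb; have r0 := le_trans a0 ar.
  have /andP[h1 h2] := dens_bounds (lexx 0) r0 rb.
  rewrite add0r expr1n divr1 in h2; rewrite h2 andbT.
  apply: le_trans h1; rewrite divr_ge0 ?exprn_ge0//.
  by rewrite addr_ge0// (le_trans r0).
by move: h; rewrite mul0r subr_ge0.
Qed.

Lemma slope_ge0 (a : R) : 0 <= a -> 0 <= slope a.
Proof. by move=> a0; rewrite -slope0 slope_le. Qed.

Lemma slope_gt0 (a : R) : 0 < a -> 0 < slope a.
Proof.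
move=> a0; have a20 : 0 < a / 2 by rewrite divr_gt0.
have a2a : a / 2 <= a by lra.
have [|h _] := andP (@slope_increment (a / 2) a
    ((a / 2) ^+ j / (a + 1) ^+ d) (a ^+ j / (a / 2 + 1) ^+ d) (ltW a20) a2a _).
  by move=> r ar ra; apply: dens_bounds => //; exact: ltW.
apply: lt_le_trans (_ : 0 < slope a - slope (a / 2)) _; last first.
  by rewrite gerBl slope_ge0// ltW.
apply: lt_le_trans h; rewrite mulr_gt0//; last by lra.
by rewrite divr_gt0 ?exprn_gt0// ltr_wpDl// ltW.
Qed.

Lemma slope_le_id (a : R) : 0 <= a -> a <= 1 -> slope a <= a.
Proof.
move=> a0 a1; have [|_ h] := andP (@slope_increment 0 a 0 1 (lexx 0) a0 _).
  move=> r r0 ra; have /andP[h1 h2] := dens_bounds (lexx 0) r0 ra.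
  rewrite add0r expr1n divr1 in h2; apply/andP; split.
    apply: le_trans h1; rewrite divr_ge0 ?exprn_ge0//.
    by rewrite addr_ge0.
  by apply: le_trans h2 _; exact: exprn_ile1.
by move: h; rewrite slope0 !subr0 mul1r.
Qed.

(** Put [A = s^(j+1) / (s+1)^d]. The density on [[s, 2s]] gives an increment of at most [2^j A], and
    the density on [[s/2, s]] gives [slope s >= A / 2^(j+1)], whence the factor
    [1 + 2^(2j+1) <= 4^(j+1)]. The lemma serves twice: in the lower bound on [profile], and to pass
    from [delta / 2] to [delta] at the end. *)
Lemma slope_double (s : R) : 0 <= s -> slope (s *+ 2) <= 4 ^+ j.+1 * slope s.
Proof.
move=> s0; have s20 : 0 <= s / 2 by rewrite divr_ge0.
have ss : s <= s *+ 2 by rewrite mulr2n lerDr.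
have s2s : s / 2 <= s by lra.
pose A : R := s ^+ j.+1 / (s + 1) ^+ d.
have [|_ h1] := andP (@slope_increment s (s *+ 2)
    (s ^+ j / (s *+ 2 + 1) ^+ d) ((s *+ 2) ^+ j / (s + 1) ^+ d) s0 ss _).
  by move=> r; exact: dens_bounds.
have [|h2 _] := andP (@slope_increment (s / 2) s
    ((s / 2) ^+ j / (s + 1) ^+ d) (s ^+ j / (s / 2 + 1) ^+ d) s20 s2s _).
  by move=> r; exact: dens_bounds.
have E1 : (s *+ 2) ^+ j / (s + 1) ^+ d * (s *+ 2 - s) = 2 ^+ j * A.
  rewrite (_ : s *+ 2 - s = s); last by rewrite mulr2n addrK.
  rewrite -[s *+ 2]mulr_natl exprMn /A exprS; ring.
have E2 : (s / 2) ^+ j / (s + 1) ^+ d * (s - s / 2) = A / 2 ^+ j.+1.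
  rewrite (_ : s - s / 2 = s / 2); last by lra.
  rewrite mulrAC -exprSr expr_div_n /A; ring.
rewrite E1 in h1; rewrite E2 ler_pdivrMr ?exprn_gt0// in h2.
have hs := slope_ge0 s20; have hs' := slope_ge0 s0.
have h3 : A <= 2 ^+ j.+1 * slope s.
  apply: le_trans h2 _; rewrite mulrC ler_wpM2l ?exprn_ge0//; lra.
have h4 : slope (s *+ 2) <= slope s + 2 ^+ j * (2 ^+ j.+1 * slope s).
  by rewrite -lerBlDl (le_trans h1)// ler_wpM2l// exprn_ge0.
apply: le_trans h4 _.
rewrite mulrA -exprD -{1}[slope s]mul1r -mulrDl ler_wpM2r//.
have -> : 4 ^+ j.+1 = 2 ^+ (j + j.+1) + 2 ^+ (j + j.+1) :> R.
  rewrite (_ : 4 = 2 ^+ 2); last by ring.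
  rewrite -exprM (_ : (2 * j.+1)%N = (j + j.+1).+1); last by lia.
  by rewrite exprS; ring.
by rewrite lerD2r exprn_ege1// ler1n.
Qed.

Lemma slope_continuous (t : R) : {within `[0, t], continuous slope}.
Proof.
have [t0|t0] := leP 0 t; 
  first exact: (primitive_continuous t0 (@dens_continuous t)).
by rewrite set_itv_ge ?bnd_simp -?ltNge//; exact: continuous_subspace0.
Qed.

Lemma profile_increment (a b : R) : 0 <= a -> a <= b ->
  slope a * (b - a) <= profile b - profile a <= slope b * (b - a).
Proof.
move=> a0 ab; apply: primitive_increment => //; first exact: slope_continuous.
by move=> r ar rb; rewrite !slope_le// (le_trans a0).
Qed.

Lemma profile_le (a b : R) : 0 <= a -> a <= b -> profile a <= profile b.
Proof.
move=> a0 ab; have /andP[h _] := profile_increment a0 ab.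
by rewrite -subr_ge0 (le_trans _ h)// mulr_ge0 ?slope_ge0// subr_ge0.
Qed.

Lemma profile_ge0 (a : R) : 0 <= a -> 0 <= profile a.
Proof. by move=> a0; rewrite -profile0 profile_le. Qed.

Lemma profile_lipschitz (a b c : R) : 0 <= a -> a <= b -> b <= c ->
  profile b - profile a <= slope c * (b - a).
Proof.
move=> a0 ab bc; have /andP[_ /le_trans] := profile_increment a0 ab; apply.
by rewrite ler_wpM2r ?subr_ge0// slope_le// (le_trans a0).
Qed.

(** Quadratic flatness at the origin: near the axis [F] is too small to undo the linear kink. *)
Lemma profile_le_sqr (a : R) : 0 <= a -> a <= 1 -> profile a <= a ^+ 2.
Proof.
move=> a0 a1; have /andP[_] := profile_increment (lexx 0) a0.
rewrite profile0 !subr0 => /le_trans; apply.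
by rewrite expr2 ler_wpM2r// slope_le_id.
Qed.

(** Only the upper half [[s/2, s]] is kept; there the slope is at least [slope (s / 2)], and
    doubling compares this with [slope s]. *)
Lemma profile_lower (s : R) : 0 <= s -> s / 2 * (slope s / 4 ^+ j.+1) <= profile s.
Proof.
move=> s0; have s20 : 0 <= s / 2 by rewrite divr_ge0.
have s2s : s / 2 <= s by lra.
have /andP[h _] := profile_increment s20 s2s.
have h1 := slope_double s20; rewrite (_ : s / 2 *+ 2 = s) in h1; last by lra.
have h2 := profile_ge0 s20.
apply: (@le_trans _ _ (slope (s / 2) * (s - s / 2))); last by lra.
rewrite (_ : s - s / 2 = s / 2); last by lra.
by rewrite mulrC ler_wpM2r// ler_pdivrMr ?exprn_gt0// mulrC.
Qed.

(** The second difference is at most [s] times the increment of [slope] over [[t - s, t + s]]. Since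
    [s <= t / 2], that interval lies in [[t/2, 2t]], where the density exceeds [dens t] by a factor
    of at most [2^(j+d)]; the length [2 s] supplies the remaining 2. *)
Lemma profile_second_difference (t s : R) : 0 < t -> 0 <= s -> s <= t / 2 ->
  profile (t + s) + profile (t - s) - profile t *+ 2 <=
    2 ^+ (j + d).+1 * dens t * s ^+ 2.
Proof.
move=> t0 s0 st.
have a0 : 0 <= t - s by lra.
have /andP[_ h1] : slope t * (t + s - t) <= profile (t + s) - profile t <=
    slope (t + s) * (t + s - t) by apply: profile_increment; lra.
have /andP[h2 _] : slope (t - s) * (t - (t - s)) <= profile t - profile (t - s)
    <= slope t * (t - (t - s)) by apply: profile_increment; lra.
have tt : t - s <= t + s by lra.
have [|_ h3] := andP (@slope_increment (t - s) (t + s)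
    ((t - s) ^+ j / (t + s + 1) ^+ d) ((t + s) ^+ j / (t - s + 1) ^+ d) a0 tt _).
  by move=> r; exact: dens_bounds.
have h4 : (t + s) ^+ j / (t - s + 1) ^+ d <= 2 ^+ (j + d) * dens t.
  have -> : 2 ^+ (j + d) * dens t = (2 * t) ^+ j / ((t + 1) / 2) ^+ d.
    by rewrite exprD exprMn expr_div_n invf_div /dens; ring.
  apply: ler_pM; rewrite ?exprn_ge0 ?invr_ge0 ?exprn_ge0//; try lra.
    by apply: lerXn2r; rewrite ?nnegrE; lra.
  rewrite lef_pV2 ?posrE ?exprn_gt0//; try lra.
  by apply: lerXn2r; rewrite ?nnegrE; lra.
have h5 : slope (t + s) - slope (t - s) <= 2 ^+ (j + d) * dens t * (s *+ 2).
  apply: le_trans h3 _; rewrite (_ : t + s - (t - s) = s *+ 2); last by lra.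
  by rewrite ler_wpM2r// mulrn_wge0.
apply: (@le_trans _ _ ((slope (t + s) - slope (t - s)) * s)); first by lra.
apply: le_trans (ler_wpM2r s0 h5) _.
by rewrite exprS le_eqVlt; apply/orP; left; apply/eqP; ring.
Qed.

End Profile.

(** * Convex functions on balls *)

Section Domain.
Context {R : realType} {n : nat}.
Implicit Types (f : 'rV[R]_n -> R) (x v e : 'rV[R]_n) (Omega : set 'rV[R]_n).

Lemma continuous_at_sum (T : topologicalType) (I : Type) (r : seq I)
    (F : I -> T -> R) (x : T) :
  (forall i, {for x, continuous (F i)}) ->
  {for x, continuous (fun y => \sum_(i <- r) F i y)}.
Proof.
move=> cF; elim: r => [|i r IH].
  rewrite (_ : (fun y => _) = cst 0); first exact: cst_continuous.
  by apply/funext => y; rewrite big_nil.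
rewrite (_ : (fun y => _) = (fun y => F i y + \sum_(k <- r) F k y)).
  by apply: continuousD; [exact: cF|exact: IH].
by apply/funext => y; rewrite big_cons.
Qed.

Lemma dot_continuous_at (T : topologicalType) (F G : T -> 'rV[R]_n) (x : T) :
  (forall i, {for x, continuous (fun y => F y 0 i)}) ->
  (forall i, {for x, continuous (fun y => G y 0 i)}) ->
  {for x, continuous (fun y => dot (F y) (G y))}.
Proof.
move=> cF cG; apply: continuous_at_sum => i.
by apply: continuousM; [exact: cF|exact: cG].
Qed.

Lemma coord_shift_continuous_at (x0 x : 'rV[R]_n) i :
  {for x, continuous (fun y : 'rV[R]_n => (y - x0) 0 i)}.
Proof.
rewrite (_ : (fun y : 'rV[R]_n => _) = (fun y => y 0 i - x0 0 i)); last first.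
  by apply/funext => y; rewrite !mxE.
by apply: continuousB; [exact: coord_continuous|exact: cst_continuous].
Qed.

(** If [y] in the ball were outside [Omega], the segment from [x0] to [y] would have a first exit
    point. It is a boundary point no farther from [x0] than [y], hence closer than [delta]. *)
Lemma eball_sub_domain Omega x0 (delta : R) : open Omega -> Omega x0 ->
  edist_to x0 (boundary Omega) = delta%:E -> eball x0 delta `<=` Omega.
Proof.
move=> oO Ox0 dE y yd; apply: contrapT => Oy.
pose w := y - x0; pose A : set R := [set s | 0 <= s <= 1 /\ ~ Omega (x0 + s *: w)].
have A1 : A 1 by split; [rewrite ler01 lexx|rewrite scale1r addrC subrK].
have A0 : has_inf A by split; [exists 1|exists 0 => s [/andP[]]].
pose t := inf A.
have lbt s : A s -> t <= s by move=> As; apply: ge_inf => //; case: A0.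
have t0 : 0 <= t by apply: lb_le_inf; [case: A0|move=> s [/andP[]]].
have t1 : t <= 1 by exact: lbt.
have Oz : ~ Omega (x0 + t *: w).
  move=> Oz; have [r r0 hr] := nbhs_line w (open_nbhs_nbhs (conj oO Oz)).
  have [a Aa atr] := inf_adherent r0 A0.
  have ta := lbt a Aa; have [_ ] := Aa; apply.
  rewrite (_ : a = t + (a - t)); last by rewrite addrC subrK.
  rewrite scalerDl addrA; apply: hr.
  by rewrite ger0_norm ?subr_ge0// ltrBlDl.
have tpos : 0 < t.
  rewrite lt_neqAle t0 andbT; apply/eqP => tE; apply: Oz.
  by rewrite -tE scale0r addr0.
have bz : boundary Omega (x0 + t *: w).
  split; last by move=> /interior_subset.
  move=> B /(nbhs_line w)[r r0 hr].
  (* Stepping back by less than both [t] and [r] lands before the first exit, hence in [Omega], and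
     still in the given neighbourhood. *)
  pose m := Num.min t r / 2.
  have m0 : 0 < Num.min t r by rewrite lt_min tpos.
  have [mt mr] : Num.min t r <= t /\ Num.min t r <= r.
    by split; rewrite ge_min lexx ?orbT.
  exists (x0 + t *: w + (- m) *: w); split; last first.
    by apply: hr; rewrite normrN ger0_norm /m; lra.
  rewrite -addrA -scalerDl; apply: contrapT => nO.
  have : A (t - m) by split=> //; rewrite /m; apply/andP; split; lra.
  by move=> /lbt; rewrite /m; lra.
have : (delta%:E <= (enorm (x0 - (x0 + t *: w)))%:E)%E.
  by rewrite -dE; apply: ereal_inf_lbound; exists (x0 + t *: w).
rewrite lee_fin opprD addrA subrr add0r enormN enormZ ger0_norm// leNgt.
move=> /negP; apply; apply: le_lt_trans yd.
by rewrite ler_piMl ?enorm_ge0.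
Qed.

(** By continuity of the gradient, a superlevel set of its length is open; being null, it is empty.
    So the essential bound holds at every point. *)
Lemma enorm_grad_le Omega f (M : R) : open Omega -> C1_on Omega f ->
  Linfty_norm Omega (grad f) = M%:E ->
  0 <= M /\ forall x, Omega x -> enorm (grad f x) <= M.
Proof.
move=> oO fC1 LM; split.
  rewrite -lee_fin -LM; apply: le_ereal_inf_tmp => _ [m [m0 _] <-].
  by rewrite lee_fin.
move=> x Ox; rewrite leNgt; apply/negP => Mx.
have : (Linfty_norm Omega (grad f) < (enorm (grad f x))%:E)%E by rewrite LM lte_fin.
move=> /ereal_inf_lt[_ [m [m0 nullm] <-]]; rewrite lte_fin => mx.
have : open [set y | Omega y /\ m < enorm (grad f y)].
  rewrite openE => y [Oy my]; apply: filterI; first exact: open_nbhs_nbhs.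
  have c : {for y, continuous (fun z => enorm (grad f z))}.
    rewrite (_ : (fun z => _) = Num.sqrt \o (fun z => dot (grad f z) (grad f z))).
      apply: continuous_comp; last exact: sqrt_continuous.
      have cg i : {for y, continuous (fun z => grad f z 0 i)}.
        rewrite (_ : (fun z => _) = partial i f); first by have [] := fC1 y Oy i.
        by apply/funext => z; rewrite mxE.
      by apply: dot_continuous_at.
    by apply/funext => z; rewrite /= enormE.
  by apply: (cvgr_gt _ c).
move=> /open_not_null/(_ nullm)/seteqP[/(_ x) + _]; exact.
Qed.

Lemma eball_segment x0 (delta : R) (a b : 'rV[R]_n) (s : R) :
  eball x0 delta a -> eball x0 delta b -> 0 <= s -> s <= 1 ->
  eball x0 delta (a + s *: (b - a)).
Proof.
rewrite /eball /= => ha hb s0 s1.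
have -> : a + s *: (b - a) - x0 = (1 - s) *: (a - x0) + s *: (b - x0).
  by apply/rowP => i; rewrite !mxE; ring.
apply: le_lt_trans (ler_enormD _ _) _; rewrite !enormZ !ger0_norm ?subr_ge0//.
move: ha hb; set p := enorm _; set q := enorm _ => ha hb.
(* The strict inequality below is drawn from the term of [a], whose weight [1 - s] vanishes at the
   endpoint. *)
have [->|s_neq1] := eqVneq s 1; first by rewrite subrr mul0r add0r mul1r.
have s1' : 0 < 1 - s by rewrite subr_gt0 lt_neqAle s_neq1.
apply: lt_le_trans (_ : (1 - s) * delta + s * delta <= _).
  by apply: ltr_leD; [rewrite ltr_pM2l|rewrite ler_wpM2l// ltW].
by rewrite -mulrDl subrK mul1r.
Qed.

Lemma lipschitz_on_eball Omega f (M : R) x0 (delta : R) (a b : 'rV[R]_n) :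
  open Omega -> C1_on Omega f ->
  (forall x, Omega x -> enorm (grad f x) <= M) -> eball x0 delta `<=` Omega ->
  eball x0 delta a -> eball x0 delta b -> f b - f a <= M * enorm (b - a).
Proof.
move=> oO fC1 fM sub ha hb.
have dg (s : R) : s \in `[0, 1] -> is_derive s 1 (fun r : R => f (a + r *: (b - a)))
    (dot (b - a) (grad f (a + s *: (b - a)))).
  rewrite in_itv/= => /andP[s0 s1]; apply: is_derive_line.
  exact: C1_is_derive oO fC1 (sub _ (eball_segment ha hb s0 s1)).
have [c] := MVT_unit dg.
rewrite in_itv/= => /andP[c0 c1].
rewrite scale1r scale0r addr0 (addrC a) subrK => ->.
apply: le_trans (ler_norm _) _; apply: le_trans (norm_dot_le _ _) _.
rewrite mulrC ler_wpM2r ?enorm_ge0// fM//.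
exact/sub/eball_segment.
Qed.

(** The ball is a convex subset of [Omega], hence an admissible set in [convex_on] even when [Omega]
    is not convex; the weight is one half. *)
Lemma midpoint_convex Omega f x0 (delta : R) (x h : 'rV[R]_n) :
  convex_on Omega f -> eball x0 delta `<=` Omega ->
  eball x0 delta (x + h) -> eball x0 delta (x - h) ->
  0 <= f (x + h) + f (x - h) - f x *+ 2.
Proof.
move=> cf sub hp hm.
have half0 : (0 : R) <= 2^-1 by rewrite invr_ge0.
have half1 : (2^-1 : R) <= 1 by lra.
have convE (t : {i01 R}) (a b : convex_lmodType 'rV[R]_n) :
    conv t a b = t%:num *: (a : 'rV[R]_n) + (1 - t%:num) *: (b : 'rV[R]_n) by [].
have cK : convex_set (eball x0 delta).
  move=> a b l; rewrite !inE => ha hb; rewrite convE.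
  rewrite (_ : _ + _ = b + l%:num *: (a - b)); first exact: eball_segment.
  by rewrite scalerBl scale1r scalerBr [RHS]addrCA.
have := cf _ sub cK (Itv01 half0 half1) (x + h) (x - h).
have convR (t : {i01 R}) (a b : R^o) :
    conv t a b = t%:num * a + (1 - t%:num) * b by [].
rewrite !inE => /(_ hp hm); rewrite convE convR /=.
rewrite (_ : _ *: _ + _ = x).
  move=> H; have {}H : f x <= 2^-1 * f (x + h) + (1 - 2^-1) * f (x - h) := H.
  by move: H; lra.
by apply/rowP => i; rewrite !mxE; field.
Qed.

End Domain.

(** * The barrier *)

Section Cylinder.
Context {R : realType} {n : nat} (d : nat) (o : nat -> 'rV[R]_n).
Context (oo : orthonormal d o).
Implicit Types (u v e : 'rV[R]_n).

(** For [v = z - x0] and [o] an orthonormal basis of the direction of [H], [axial v] is the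
    component [x] of the overview, [axial_sqr v] is [|x|^2], and [radius v] is [t = |y|]. *)
Definition axial_sqr v : R := \sum_(i < d) dot v (o i) ^+ 2.
Definition axial v : 'rV[R]_n := \sum_(i < d) dot v (o i) *: o i.
Definition radius v : R := enorm (v - axial v).

Lemma dot_axial v (k : 'I_d) : dot (axial v) (o k) = dot v (o k).
Proof.
rewrite dot_suml (bigD1 k)//= big1 ?addr0 => [|i ik].
  by rewrite dotZl oo// eqxx mulr1.
by rewrite dotZl oo// (inj_eq val_inj) (negbTE ik) mulr0.
Qed.

Lemma dot_axial_l u v : (forall k : 'I_d, dot u (o k) = 0) -> dot u (axial v) = 0.
Proof.
by move=> h; rewrite dotC dot_suml big1// => i _; rewrite dotZl (dotC (o i)) h mulr0.
Qed.

Lemma dot_radial v (k : 'I_d) : dot (v - axial v) (o k) = 0.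
Proof. by rewrite dotBl dot_axial subrr. Qed.

Lemma dot_axial_axial v : dot (axial v) (axial v) = axial_sqr v.
Proof.
rewrite {1}/axial dot_suml; apply: eq_bigr => i _.
by rewrite dotZl (dotC (o i)) dot_axial expr2.
Qed.

Lemma axial_sqr_ge0 v : 0 <= axial_sqr v.
Proof. by apply: sumr_ge0 => i _; exact: sqr_ge0. Qed.

Lemma radius_ge0 v : 0 <= radius v. Proof. exact: enorm_ge0. Qed.

Lemma sqr_radius v : radius v ^+ 2 = dot v v - axial_sqr v.
Proof.
rewrite sqr_enorm dotBr [X in _ - X]dot_axial_l ?subr0; last exact: dot_radial.
rewrite dotBl; congr (_ - _).
apply/eqP; rewrite -subr_eq0 -dot_axial_axial -dotBr.
by rewrite dotC dot_axial_l//; exact: dot_radial.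
Qed.

Lemma axial_sqr_line v e (s : R) : axial_sqr (v + s *: e) =
  axial_sqr v + 2 * s * \sum_(i < d) (dot v (o i) * dot e (o i))
  + s ^+ 2 * axial_sqr e.
Proof.
rewrite /axial_sqr !mulr_sumr -!big_split; apply: eq_bigr => i _ /=.
by rewrite dotDl dotZl; ring.
Qed.

Lemma axial_sqr_normal_line v e (s : R) : (forall k : 'I_d, dot e (o k) = 0) ->
  axial_sqr (v + s *: e) = axial_sqr v.
Proof. by move=> eo; apply: eq_bigr => i _; rewrite dotDl dotZl eo mulr0 addr0. Qed.

Lemma axial_sqr_basis (k : 'I_d) : axial_sqr (o k) = 1.
Proof.
rewrite /axial_sqr (bigD1 k)//= oo// eqxx expr1n big1 ?addr0// => i ik.
by rewrite oo// eq_sym (inj_eq val_inj) (negbTE ik) expr0n.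
Qed.

Lemma radius_axial_line v (k : 'I_d) (s : R) : radius (v + s *: o k) = radius v.
Proof.
rewrite /radius; congr enorm.
have -> : axial (v + s *: o k) = axial v + s *: o k.
  have E : s *: o k = \sum_(i < d) (s * dot (o k) (o i)) *: o i.
    rewrite (bigD1 k)//= oo// eqxx mulr1 big1 ?addr0// => i ik.
    by rewrite oo// eq_sym (inj_eq val_inj) (negbTE ik) mulr0 scale0r.
  rewrite [in RHS]E -big_split; apply: eq_bigr => i _.
  by rewrite /= -scalerDl dotDl dotZl.
by rewrite opprD addrACA subrr addr0.
Qed.

Lemma sqr_radius_normal_line v e (s : R) : (forall k : 'I_d, dot e (o k) = 0) ->
  radius (v + s *: e) ^+ 2 = radius v ^+ 2 + 2 * s * dot v e + s ^+ 2 * dot e e.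
Proof.
move=> eo; rewrite !sqr_radius axial_sqr_normal_line//.
rewrite !(dotDl, dotDr, dotZl, dotZr) (dotC e v); ring.
Qed.

Lemma radius_eq_sqr (x : R) v : 0 <= x -> radius v ^+ 2 = x ^+ 2 -> radius v = x.
Proof.
by move=> x0 h; apply/eqP; rewrite -(eqrXn2 (_ : 0 < 2)%N) ?radius_ge0// h.
Qed.

Lemma radial_unit v : 0 < radius v ->
  let e := (radius v)^-1 *: (v - axial v) in
  [/\ dot e e = 1, forall k : 'I_d, dot e (o k) = 0 & dot v e = radius v].
Proof.
move=> t0 e; have t_neq0 : radius v != 0 by rewrite gt_eqF.
split.
- by rewrite /e dotZl dotZr -sqr_enorm -/(radius v); field.
- by move=> k; rewrite /e dotZl dot_radial mulr0.
- rewrite /e dotZr dotC (_ : dot _ v = radius v ^+ 2); first by field.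
  rewrite sqr_enorm [in RHS]dotBr [X in _ = _ - X]dot_axial_l ?subr0//.
  exact: dot_radial.
Qed.

Lemma axial_sqr_continuous_at (x0 x : 'rV[R]_n) :
  {for x, continuous (fun y : 'rV[R]_n => axial_sqr (y - x0))}.
Proof.
apply: (@continuous_at_sum _ _ _ _
  (fun (i : 'I_d) (y : 'rV[R]_n) => dot (y - x0) (o i) ^+ 2)) => i.
have c : {for x, continuous (fun y : 'rV[R]_n => dot (y - x0) (o i))}.
  apply: dot_continuous_at => k; first exact: coord_shift_continuous_at.
  exact: cst_continuous.
exact: (continuousM c c).
Qed.

Lemma radius_continuous_at (x0 x : 'rV[R]_n) :
  {for x, continuous (fun y : 'rV[R]_n => radius (y - x0))}.
Proof.
rewrite (_ : (fun y => _) = Num.sqrt \o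
    (fun y : 'rV[R]_n => dot (y - x0) (y - x0) - axial_sqr (y - x0))).
  apply: continuous_comp; last exact: sqrt_continuous.
  apply: continuousB; last exact: axial_sqr_continuous_at.
  by apply: dot_continuous_at => k; exact: coord_shift_continuous_at.
apply/funext => y /=; rewrite -sqr_radius sqrtr_sqr ger0_norm//.
exact: radius_ge0.
Qed.

End Cylinder.

(** The numerical part of the product of Hessian bounds: 32 from each axial direction, [4 + K] from
    each of the [j] tangential ones, then the loss in [profile_second_difference] and the factor [K]
    of [L] from the radial one, with [K = 20 * 4 ^+ j.+1]. *)
Definition barrier_constant (R : realType) (d j : nat) : R :=
  32 ^+ d * (4 + 20 * 4 ^+ j.+1) ^+ j * 2 ^+ (j + d).+1 * (20 * 4 ^+ j.+1).

Section Barrier.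
Context {R : realType} {n d j : nat} (nE : n = (d + j.+1)%N).
Context (Omega : set 'rV[R]_n) (psi : 'rV[R]_n -> R) (x0 : 'rV[R]_n).
Context (o : nat -> 'rV[R]_n) (delta ell M gam Lam : R).
Context (oO : open Omega) (psiC2 : C2_on Omega psi) (oo : orthonormal d o).
Context (sub : eball x0 delta `<=` Omega).
Context (mid : forall x h, eball x0 delta (x + h) -> eball x0 delta (x - h) ->
  0 <= psi (x + h) + psi (x - h) - psi x *+ 2).
Context (lip : forall a b, eball x0 delta a -> eball x0 delta b ->
  psi b - psi a <= M * enorm (b - a)).
Context (psi0 : psi x0 = 0) (M0 : 0 < M) (gam0 : 0 < gam) (ell0 : 0 < ell).
Context (elld : ell <= delta / 2) (gamd : gam <= delta / 2).
Context (small : forall v, enorm (axial d o v) < ell ->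
  psi (x0 + axial d o v) <= gam * M).
Context (detpsi : forall x, Omega x -> Lam <= \det (hessian psi x)).

Let D : R := delta / 2.
(* Doubling costs [4 ^+ j.+1] in [profile_lower]; the factor 20 then gives
   [F D >= 5 M (gam + D)]. *)
Let K : R := 20 * 4 ^+ j.+1.
Let S : R := slope j d (D / gam).
(** Formally [F' t = L / gam * slope (t / gam)], so this choice makes it [K * M] at [t = D]. *)
Let L : R := K * M * gam / S.
Let F (t : R) : R := L * profile j d (t / gam).
Let X (z : 'rV[R]_n) : R := axial_sqr d o (z - x0).
Let T (z : 'rV[R]_n) : R := radius d o (z - x0).
(** On the cylinder the bracket runs from [-1/4] at [a = 0] to [1/4] on the lateral side, so the
    first term runs from [-4 M (gam + t)] to [4 M (gam + t)]. The middle term is small enough to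
    leave [w 0 0 = - 2 gam M < 0]. *)
Let w (a t : R) : R :=
  16 * M * (gam + t) * (a / ell ^+ 2 - 4^-1) + 2 * gam * M + F t.
(** The bound [ell ^+ 2 / 2] puts the axial part strictly inside the ball of radius [ell], where
    [small] applies. *)
Let cyl : set 'rV[R]_n := [set z | X z <= ell ^+ 2 / 2 /\ T z <= D].

Let D_gt0 : 0 < D. Proof. exact: lt_le_trans gam0 gamd. Qed.
Let K_gt0 : 0 < K. Proof. by rewrite mulr_gt0// exprn_gt0. Qed.
Let S_gt0 : 0 < S. Proof. by apply: slope_gt0; rewrite divr_gt0. Qed.
Let L_gt0 : 0 < L. Proof. by rewrite !(mulr_gt0, invr_gt0). Qed.
Let ell2_gt0 : 0 < ell ^+ 2. Proof. by rewrite exprn_gt0. Qed.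

Let scaled_ge0 (a : R) : 0 <= a -> 0 <= a / gam.
Proof. by move=> a0; rewrite divr_ge0// ltW. Qed.

Let scaled_le (a b : R) : a <= b -> a / gam <= b / gam.
Proof. by move=> ab; rewrite ler_pM2r ?invr_gt0. Qed.

Let F0 : F 0 = 0. Proof. by rewrite /F mul0r profile0 mulr0. Qed.

Let F_ge0 (a : R) : 0 <= a -> 0 <= F a.
Proof. by move=> a0; rewrite mulr_ge0 ?(ltW L_gt0)// profile_ge0// scaled_ge0. Qed.

Let F_le (a b : R) : 0 <= a -> a <= b -> F a <= F b.
Proof.
by move=> a0 ab; rewrite ler_wpM2l ?(ltW L_gt0)// profile_le ?scaled_ge0 ?scaled_le.
Qed.

Let F_lip (a b : R) : 0 <= a -> a <= b -> b <= D -> F b - F a <= K * M * (b - a).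
Proof.
move=> a0 ab bD; rewrite -mulrBr.
have := profile_lipschitz j d (scaled_ge0 a0) (scaled_le ab) (scaled_le bD).
rewrite -/S => /(ler_wpM2l (ltW L_gt0))/le_trans; apply.
rewrite le_eqVlt; apply/orP; left; apply/eqP; rewrite /L.
by field; rewrite (gt_eqF gam0) (gt_eqF S_gt0).
Qed.

Let F_low : 10 * M * D <= F D.
Proof.
have := profile_lower j d (scaled_ge0 (ltW D_gt0)).
rewrite -/S => /(ler_wpM2l (ltW L_gt0)); apply: le_trans.
rewrite le_eqVlt; apply/orP; left; apply/eqP; rewrite /L /K.
field; rewrite (gt_eqF gam0) (gt_eqF S_gt0) /= expf_neq0//.
Qed.

Let X_ge0 z : 0 <= X z. Proof. exact: axial_sqr_ge0. Qed.
Let T_ge0 z : 0 <= T z. Proof. exact: radius_ge0. Qed.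

Let sqr_dist z : dot (z - x0) (z - x0) = X z + T z ^+ 2.
Proof. by rewrite /X /T sqr_radius// [RHS]addrC subrK. Qed.

Let lt_enorm (v : 'rV[R]_n) (r : R) : 0 < r -> dot v v < r ^+ 2 -> enorm v < r.
Proof.
move=> r0; rewrite -sqr_enorm ltr_pXn2r ?nnegrE ?enorm_ge0//; exact: ltW.
Qed.

Let cyl_ball z : cyl z -> eball x0 delta z.
Proof.
move=> [Xz Tz]; have d0 : 0 < delta by have := D_gt0; rewrite /D; lra.
apply: lt_enorm => //; rewrite sqr_dist.
have h1 : ell ^+ 2 <= (delta / 2) ^+ 2.
  by apply: lerXn2r; rewrite ?nnegrE ?(ltW ell0) ?divr_ge0 ?(ltW d0).
have h2 : T z ^+ 2 <= (delta / 2) ^+ 2.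
  by apply: lerXn2r; rewrite ?nnegrE ?T_ge0// divr_ge0// ltW.
have h3 : 0 < delta ^+ 2 by rewrite exprn_gt0.
have h4 : (delta / 2) ^+ 2 = delta ^+ 2 / 4 by field.
lra.
Qed.

(** Project [z] to the axial plane through [x0]: there [small] gives [gam * M], and the way back has
    length [T z], costing at most [M * T z]. *)
Let psi_le z : cyl z -> psi z <= M * (gam + T z).
Proof.
move=> cz; have [Xz Tz] := cz.
have ax : enorm (axial d o (z - x0)) < ell.
  apply: lt_enorm => //; rewrite dot_axial_axial//.
  by move: Xz ell2_gt0; rewrite /X; lra.
have b : eball x0 delta (x0 + axial d o (z - x0)).
  by rewrite /eball /= addrAC subrr add0r (lt_le_trans ax)//; move: ell0 elld; lra.
have := lip b (cyl_ball cz); have := small ax.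
rewrite opprD addrA -/(radius d o (z - x0)) -/(T z); lra.
Qed.

Let F_radius_continuous z : {for z, continuous (fun y => F (T y))}.
Proof.
have cT : {for z, continuous T} by exact: radius_continuous_at.
(* A Lipschitz constant for [F] on [[0, T z + 1]], the slope being largest at the right end. *)
pose c := slope j d ((T z + 1) / gam) / gam * L.
have c0 : 0 <= c.
  rewrite mulr_ge0 ?(ltW L_gt0)// divr_ge0 ?(ltW gam0)// slope_ge0//.
  by rewrite scaled_ge0// addr_ge0// T_ge0.
have Fc (a b : R) : 0 <= a -> a <= b -> b <= T z + 1 ->
    `|F b - F a| <= c * (b - a).
  move=> a0 ab bT; rewrite ger0_norm ?subr_ge0 ?F_le// -mulrBr.
  have := profile_lipschitz j d (scaled_ge0 a0) (scaled_le ab) (scaled_le bT).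
  move=> /(ler_wpM2l (ltW L_gt0))/le_trans; apply.
  by rewrite le_eqVlt; apply/orP; left; apply/eqP; rewrite /c; ring.
suff : forall e : R, 0 < e -> \forall y \near z, `|F (T z) - F (T y)| <= e.
  by move=> h; exact/(@cvgrPdist_le _ _ _ (nbhs z) (nbhs_filter z)).
move=> e e0; have e1 : 0 < e / (c + 1) by rewrite divr_gt0// ltr_wpDl.
have h1 : \forall y \near z, `|T z - T y| <= e / (c + 1).
  by move/cvgrPdist_le: cT; exact.
have h2 : \forall y \near z, T y < T z + 1.
  by apply: (cvgr_lt _ cT); rewrite ltrDl.
near=> y.
have d1 : `|T z - T y| <= e / (c + 1) by near: y.
have d2 : T y < T z + 1 by near: y.
have d3 : c * `|T z - T y| <= e.
  rewrite ler_pdivlMr ?ltr_wpDl// in d1.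
  apply: le_trans d1; rewrite mulrC ler_wpM2l//; lra.
apply: le_trans d3; have [le_zy|lt_yz] := leP (T z) (T y).
  rewrite distrC (distrC (T z)) [X in _ <= _ * X]ger0_norm ?subr_ge0// Fc ?T_ge0//.
  exact: ltW.
rewrite [X in _ <= _ * X]ger0_norm ?subr_ge0 ?(ltW lt_yz)// Fc ?T_ge0 ?(ltW lt_yz)//.
by rewrite lerDl.
Unshelve. all: by end_near. Qed.

Let w_continuous z : {for z, continuous (fun y => w (X y) (T y))}.
Proof.
apply: continuousD; last exact: F_radius_continuous.
apply: continuousD; last exact: cst_continuous.
apply: continuousM.
  apply: continuousM; first exact: cst_continuous.
  by apply: continuousD; [exact: cst_continuous|exact: radius_continuous_at].
apply: continuousB; last exact: cst_continuous.
by apply: continuousM; [exact: axial_sqr_continuous_at|exact: cst_continuous].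
Qed.

Let cyl_compact : compact cyl.
Proof.
apply: (@subclosed_compact _ _
    [set z : 'rV[R]_n | forall i,
      `[x0 0 i - delta, x0 0 i + delta]%classic (z ord0 i)]).
- apply: closedI.
    apply: (@preimage_closed _ _ X [set x | x <= ell ^+ 2 / 2]); last exact: closed_le.
    by move=> z _; exact: axial_sqr_continuous_at.
  apply: (@preimage_closed _ _ T [set x | x <= D]); last exact: closed_le.
  by move=> z _; exact: radius_continuous_at.
- apply: (@rV_compact _ _ (fun i => `[x0 0 i - delta, x0 0 i + delta]%classic)).
  by move=> i; exact: segment_compact.
- move=> z /cyl_ball zb i; rewrite /= in_itv/=.
  have := le_lt_trans (norm_coord_le_enorm (z - x0) i) zb.
  by rewrite !mxE ltr_norml => /andP[h1 h2]; apply/andP; split; lra.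
Qed.

(** The value at [x0] is [2 gam M], and on the lateral side and on the top [psi - w] is negative.
    The lower bound on the maximum is kept because it is what excludes the axis. *)
Let max_point : exists z, [/\ X z < ell ^+ 2 / 2, T z < D, cyl z,
  2 * gam * M <= psi z - w (X z) (T z) &
  forall y, cyl y -> psi y - w (X y) (T y) <= psi z - w (X z) (T z)].
Proof.
have X0 : X x0 = 0.
  by rewrite /X subrr; apply: big1 => i _; rewrite dot0l expr0n.
have T0 : T x0 = 0.
  apply/eqP; rewrite -sqrf_eq0; apply/eqP.
  by have := sqr_dist x0; rewrite X0 subrr dot0l add0r.
have cyl0 : cyl x0 by split; rewrite ?X0 ?T0 ?(ltW D_gt0)// divr_ge0// ltW.
have cf : {within cyl, continuous (fun z => psi z - w (X z) (T z))}.
  apply: continuous_in_subspaceT => z; rewrite inE => /cyl_ball/sub Oz.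
  have c : {for z, continuous psi} by have [] := psiC2 Oz.
  exact: (continuousB c (w_continuous (z := z))).
have [|z] := compact_EVT_max _ cyl_compact cf; first by exists x0.
rewrite inE => cz zmax.
have {}zmax y : cyl y -> psi y - w (X y) (T y) <= psi z - w (X z) (T z).
  by move=> cy; apply: zmax; rewrite inE.
have pos : 2 * gam * M <= psi z - w (X z) (T z).
  apply: le_trans (zmax _ cyl0); rewrite psi0 X0 T0 /w F0.
  rewrite mul0r; lra.
have [Xz Tz] := cz; have pz := psi_le cz; have tz := T_ge0 z.
have gM : 0 < gam * M by rewrite mulr_gt0.
have tM : 0 <= M * T z by rewrite mulr_ge0// ltW.
have Fz := F_ge0 tz.
exists z; split=> //.
  (* Lateral side: [w >= 4 M (gam + t) + 2 gam M], while [psi <= M (gam + t)]. *)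
  rewrite lt_neqAle Xz andbT; apply/eqP => XE.
  have : X z / ell ^+ 2 = 2^-1 by rewrite XE; field; rewrite gt_eqF.
  by move: pos; rewrite /w => + XE'; rewrite XE'; lra.
(* Top: [psi - w <= 5 M (gam + D) - 2 gam M - 10 M D], which is at most [- 2 gam M] since
   [gam <= D]. *)
rewrite lt_neqAle Tz andbT; apply/eqP => TE.
have u0 : 0 <= X z / ell ^+ 2 by rewrite divr_ge0// ltW.
have : - (4 * M * (gam + D)) <= 16 * M * (gam + D) * (X z / ell ^+ 2 - 4^-1).
  have : 0 <= M * (gam + D) * (X z / ell ^+ 2).
    by rewrite mulr_ge0// mulr_ge0 ?ltW// addr_gt0.
  lra.
have gD : gam * M <= D * M by rewrite ler_pM2r.
have := F_low; move: pos pz; rewrite /w TE; lra.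
Qed.

Let shift_line z e (s : R) : z + s *: e - x0 = z - x0 + s *: e.
Proof. by rewrite addrAC. Qed.

Let cyl_line z e : X z < ell ^+ 2 / 2 -> T z < D ->
  exists2 r : R, 0 < r & forall s : R, `|s| < r -> cyl (z + s *: e).
Proof.
move=> Xz Tz.
have : \forall y \near z, X y < ell ^+ 2 / 2 /\ T y < D.
  apply: filterI.
    by apply: (cvgr_lt _
      (axial_sqr_continuous_at (d := d) (o := o) (x0 := x0) (x := z))).
  by apply: (cvgr_lt _ (radius_continuous_at oo (x0 := x0) (x := z))).
move=> /(nbhs_line e)[r r0 hr]; exists r => // s /hr[h1 h2].
by split; exact: ltW.
Qed.

Let second_difference_at_max z e (s : R) : cyl (z + s *: e) -> cyl (z - s *: e) ->
  (forall y, cyl y -> psi y - w (X y) (T y) <= psi z - w (X z) (T z)) ->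
  psi (z + s *: e) + psi (z - s *: e) - psi z *+ 2 <=
    w (X (z + s *: e)) (T (z + s *: e)) + w (X (z - s *: e)) (T (z - s *: e))
    - w (X z) (T z) *+ 2.
Proof.
move=> cp cm zmax; have := zmax _ cp; have := zmax _ cm.
move: (w _ _) (w _ _) (w _ _) (psi _) (psi _) (psi _) => a b c p q r; lra.
Qed.

Let X_normal z e (s : R) : (forall k : 'I_d, dot e (o k) = 0) ->
  X (z + s *: e) = X z.
Proof. by move=> eo; rewrite /X shift_line axial_sqr_normal_line. Qed.

Let T_normal z e (s : R) : (forall k : 'I_d, dot e (o k) = 0) ->
  T (z + s *: e) ^+ 2 =
    T z ^+ 2 + 2 * s * dot (z - x0) e + s ^+ 2 * dot e e.
Proof. by move=> eo; rewrite /T shift_line sqr_radius_normal_line. Qed.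

Let T_eq z (a : R) : 0 <= a -> T z ^+ 2 = a ^+ 2 -> T z = a.
Proof. exact: radius_eq_sqr. Qed.

(* On the axis the barrier has a concave kink in the normal directions, which a
   convex function cannot touch from below. *)
Let max_off_axis z : X z < ell ^+ 2 / 2 -> T z < D -> cyl z ->
  2 * gam * M <= psi z - w (X z) (T z) ->
  (forall y, cyl y -> psi y - w (X y) (T y) <= psi z - w (X z) (T z)) ->
  0 < T z.
Proof.
move=> Xz Tz cz pos zmax; rewrite lt_neqAle T_ge0 andbT; apply/eqP => T0.
have dn : (d < \dim {:'rV[R]_n})%N.
  by rewrite dimvf [dim _]mul1n nE addnS ltnS leq_addr.
have [e _ [ee eo']] := exists_unit_orthogonal o dn.
have eo (k : 'I_d) : dot e (o k) = 0 by exact: eo'.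
have [r r0 hr] := cyl_line e Xz Tz.
have ze : dot (z - x0) e = 0.
  have v0 : z - x0 = axial d o (z - x0).
    apply/eqP; rewrite -subr_eq0 -dot_eq0 -sqr_enorm.
    by rewrite -/(radius d o (z - x0)) -/(T z) -T0 expr0n.
  by rewrite v0 dotC dot_axial_l.
have TE (s : R) : 0 <= s -> T (z + s *: e) = s.
  by move=> s0; apply: T_eq => //; rewrite T_normal// -T0 ze ee; ring.
have TE' (s : R) : 0 <= s -> T (z - s *: e) = s.
  by move=> s0; apply: T_eq => //; rewrite -scaleNr T_normal// -T0 ze ee; ring.
(* [r / 2] keeps both points in the cylinder, [gam] makes [profile_le_sqr] applicable at [m / gam],
   and the last bound turns [L (m / gam)^2] into at most [M m]. *)
pose m := Num.min (r / 2) (Num.min gam (M * gam ^+ 2 / L)).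
have m0 : 0 < m.
  by rewrite !lt_min gam0 !divr_gt0 ?mulr_gt0 ?exprn_gt0.
have [m1 [m2 m3]] : m <= r / 2 /\ m <= gam /\ m <= M * gam ^+ 2 / L.
  by split; [|split]; rewrite /m !ge_min lexx ?orbT.
have mr : `|m| < r by rewrite gtr0_norm//; lra.
have cp := hr m mr.
have cm : cyl (z - m *: e) by rewrite -scaleNr; apply: hr; rewrite normrN.
have := mid (cyl_ball cp) (cyl_ball cm).
have := second_difference_at_max cp cm zmax.
rewrite (TE _ (ltW m0)) (TE' _ (ltW m0)) -scaleNr !X_normal// scaleNr -T0 => h1 h2.
have h3 : F m <= M * m.
  have := profile_le_sqr j d (scaled_ge0 (ltW m0)).
  rewrite ler_pdivrMr// mul1r => /(_ m2)/(ler_wpM2l (ltW L_gt0))/le_trans; apply.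
  rewrite ler_pdivlMr// in m3.
  rewrite expr_div_n mulrA ler_pdivrMr ?exprn_gt0//.
  have := ler_wpM2r (ltW m0) m3; rewrite -/L; lra.
have pz := psi_le cz; rewrite -T0 addr0 in pz.
rewrite -T0 /w F0 in pos; rewrite /w F0 in h1.
have Mm : 0 < M * m by rewrite mulr_gt0.
set u := X z / ell ^+ 2 - 4^-1 in pos h1.
(* From [psi z <= gam M] and a maximum of at least [2 gam M] follows
   [16 gam M u + 2 gam M <= - gam M]. The second difference of [w] is then at most
   [2 (- 3 M m + M m) < 0], whereas that of [psi] is nonnegative. *)
have h4 : 16 * (M * u) <= - 3 * M.
  rewrite -(ler_pM2l gam0); move: pos pz; rewrite addr0; lra.
have h5 : 16 * M * m * u <= - 3 * (M * m).
  have := ler_wpM2r (ltW m0) h4; lra.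
move: (psi (z + m *: e)) (psi (z - m *: e)) h1 h2 => p q; lra.
Qed.

Let axial_bound : R -> R := fun t => 32 * M * (gam + t) / ell ^+ 2.
Let tangential_bound : R -> R := fun t => (4 + K) * M / t.
Let radial_bound : R -> R := fun t =>
  L * 2 ^+ (j + d).+1 * dens j d (t / gam) / gam ^+ 2.

Let u_bounds z : cyl z -> - 4^-1 <= X z / ell ^+ 2 - 4^-1 <= 4^-1.
Proof.
move=> [Xz _]; have : 0 <= X z / ell ^+ 2 by rewrite divr_ge0// ltW.
have : X z / ell ^+ 2 <= 2^-1 by rewrite ler_pdivrMr// mulrC.
by move=> h1 h2; apply/andP; split; lra.
Qed.

(** Along [o k] the radius is constant and [X] is a quadratic polynomial with leading coefficient 1,
    so the second difference of the barrier is exactly the bound times [s^2]. *)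
Let axial_hessian z (k : 'I_d) : X z < ell ^+ 2 / 2 -> T z < D -> Omega z ->
  (forall y, cyl y -> psi y - w (X y) (T y) <= psi z - w (X z) (T z)) ->
  (o k *m hessian psi z *m (o k)^T) 0 0 <= axial_bound (T z).
Proof.
move=> Xz Tz Oz zmax; have [r r0 hr] := cyl_line (o k) Xz Tz.
apply: (quadform_hessian_le oO psiC2 Oz r0) => s s0 sr.
have cp : cyl (z + s *: o k) by apply: hr; rewrite gtr0_norm.
have cm : cyl (z - s *: o k).
  by rewrite -scaleNr; apply: hr; rewrite normrN gtr0_norm.
apply: le_trans (second_difference_at_max cp cm zmax) _.
rewrite -scaleNr /X /T !shift_line !axial_sqr_line !radius_axial_line//.
rewrite axial_sqr_basis// /w /axial_bound -/(T z).
move: (\sum_(i < d) _) (axial_sqr d o _) (F _) => p q f.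
rewrite le_eqVlt; apply/orP; left; apply/eqP; field.
by rewrite gt_eqF.
Qed.

(** Both steps along [e] raise the radius from [t] to [sqrt (t^2 + s^2) <= t + s^2 / (2 t)]. In [t]
    the barrier grows at rate at most [(4 + K) M]: [4 M] because the bracket is at most [1/4], and
    [K M] by [F_lip]. *)
Let tangential_hessian z e : X z < ell ^+ 2 / 2 -> T z < D -> Omega z ->
  cyl z -> 0 < T z ->
  (forall y, cyl y -> psi y - w (X y) (T y) <= psi z - w (X z) (T z)) ->
  (forall k : 'I_d, dot e (o k) = 0) -> dot e e = 1 -> dot (z - x0) e = 0 ->
  (e *m hessian psi z *m e^T) 0 0 <= tangential_bound (T z).
Proof.
move=> Xz Tz Oz cz T0 zmax eo ee ze; have [r r0 hr] := cyl_line e Xz Tz.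
apply: (quadform_hessian_le oO psiC2 Oz r0) => s s0 sr.
have cp : cyl (z + s *: e) by apply: hr; rewrite gtr0_norm.
have cm : cyl (z - s *: e).
  by rewrite -scaleNr; apply: hr; rewrite normrN gtr0_norm.
apply: le_trans (second_difference_at_max cp cm zmax) _.
have sq : T (z + s *: e) ^+ 2 = T z ^+ 2 + s ^+ 2.
  by rewrite T_normal// ze ee; ring.
have -> : T (z - s *: e) = T (z + s *: e).
  apply: T_eq; first exact: T_ge0.
  by rewrite -scaleNr (T_normal z (- s) eo) sq ze ee; ring.
rewrite -scaleNr !X_normal//.
have [_ TD] := cp.
have T1 : T z <= T (z + s *: e).
  rewrite -(ler_pXn2r (_ : 0 < 2)%N) ?nnegrE//.
  by rewrite sq lerDl sqr_ge0.
have T2 : T (z + s *: e) - T z <= s ^+ 2 / (2 * T z).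
  rewrite lerBlDl -(ler_pXn2r (_ : 0 < 2)%N) ?nnegrE//; last first.
    by rewrite addr_ge0// divr_ge0 ?sqr_ge0// mulr_ge0.
  rewrite sq sqrrD (_ : T z * (s ^+ 2 / (2 * T z)) *+ 2 = s ^+ 2).
    by rewrite lerDl sqr_ge0.
  by field; rewrite gt_eqF.
have FT := F_lip (T_ge0 z) T1 TD.
move: (T (z + s *: e)) T1 T2 FT => t T1 T2 FT.
have := u_bounds cz; rewrite /w /tangential_bound.
move: (X z / ell ^+ 2 - 4^-1) => u /andP[_ u4].
have h1 : M * (t - T z) * u <= M * (t - T z) * 4^-1.
  by rewrite ler_wpM2l// mulr_ge0 ?(ltW M0) ?subr_ge0.
have [q qE] : exists q, q = s ^+ 2 / (2 * T z) by exists (s ^+ 2 / (2 * T z)).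
rewrite -qE in T2.
have h2 : (4 + K) * M * (t - T z) <= (4 + K) * M * q.
  by rewrite ler_wpM2l// mulr_ge0 ?(ltW M0)// addr_ge0// ltW.
rewrite (_ : (4 + K) * M / T z * s ^+ 2 = 2 * ((4 + K) * M * q)).
  move: FT h1 h2; by move: (F t) (T z) (K) => f1 tz k; lra.
by rewrite qE; field; rewrite gt_eqF.
Qed.

(** At fixed [X] the barrier is affine in [t] apart from [F], so only [F] contributes. *)
Let radial_hessian z e : X z < ell ^+ 2 / 2 -> T z < D -> Omega z ->
  cyl z -> 0 < T z ->
  (forall y, cyl y -> psi y - w (X y) (T y) <= psi z - w (X z) (T z)) ->
  (forall k : 'I_d, dot e (o k) = 0) -> dot e e = 1 ->
  dot (z - x0) e = T z ->
  (e *m hessian psi z *m e^T) 0 0 <= radial_bound (T z).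
Proof.
move=> Xz Tz Oz cz T0 zmax eo ee ze; have [r r0 hr] := cyl_line e Xz Tz.
have r1 : 0 < Num.min r (T z / 2) by rewrite lt_min r0 divr_gt0.
apply: (quadform_hessian_le oO psiC2 Oz r1) => s s0.
rewrite lt_min => /andP[sr sT].
have cp : cyl (z + s *: e) by apply: hr; rewrite gtr0_norm.
have cm : cyl (z - s *: e).
  by rewrite -scaleNr; apply: hr; rewrite normrN gtr0_norm.
apply: le_trans (second_difference_at_max cp cm zmax) _.
have -> : T (z + s *: e) = T z + s.
  apply: T_eq; first by rewrite addr_ge0// ltW.
  by rewrite T_normal// ze ee; ring.
have -> : T (z - s *: e) = T z - s.
  apply: T_eq; first by move: T0; lra.
  by rewrite -scaleNr T_normal// ze ee; ring.
rewrite -scaleNr !X_normal//.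
have t0 : 0 < T z / gam by rewrite divr_gt0.
have s1 : s / gam <= T z / gam / 2.
  by rewrite mulrAC scaled_le// ltW.
have := profile_second_difference j d t0 (scaled_ge0 (ltW s0)) s1.
rewrite -mulrDl -mulrBl => /(ler_wpM2l (ltW L_gt0)) h.
apply: (@le_trans _ _ (F (T z + s) + F (T z - s) - F (T z) *+ 2)).
  by rewrite /w le_eqVlt; apply/orP; left; apply/eqP; ring.
rewrite /F -mulrDr -mulrnAr -mulrBr; apply: le_trans h _.
rewrite le_eqVlt; apply/orP; left; apply/eqP; rewrite /radial_bound.
by field; rewrite gt_eqF.
Qed.

Let bounds_product (t : R) : 0 < t ->
  axial_bound t ^+ d * (radial_bound t * tangential_bound t ^+ j) =
  barrier_constant R d j * M ^+ n * gam ^+ d / (ell ^+ (2 * d) * gam ^+ j.+1 * S).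
Proof.
have gn : gam != 0 by rewrite gt_eqF.
(* In the variable [tau = t / gam] one has [gam + t = gam (tau + 1)], and [dens tau] cancels the
   powers of [tau] and [tau + 1] in the other two bounds. *)
move=> t0; have [tau tau0 ->] : exists2 tau, 0 < tau & t = tau * gam.
  by exists (t / gam); rewrite ?divr_gt0// divfK.
rewrite /barrier_constant /axial_bound /radial_bound /tangential_bound -/K mulfK//.
have -> : gam + tau * gam = gam * (tau + 1) by ring.
rewrite exprM; move: (ell ^+ 2) ell2_gt0 => e2 e2_gt0.
rewrite /dens nE !exprMn !exprVn !exprMn !exprD !exprS expr0 /L.
have ln : e2 ^+ d != 0 by rewrite expf_neq0// gt_eqF.
have tn : tau ^+ j != 0 by rewrite expf_neq0// gt_eqF.
have gjn : gam ^+ j != 0 by rewrite expf_neq0.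
have t1n : (tau + 1) ^+ d != 0 by rewrite expf_neq0// gt_eqF// addr_gt0.
have sn : S != 0 by rewrite gt_eqF.
move: (tau ^+ j) ((tau + 1) ^+ d) (gam ^+ j) (gam ^+ d) (e2 ^+ d)
  ((4 + K) ^+ j) (32 ^+ d) (2 ^+ (j + d)) (M ^+ d) (M ^+ j) ln tn gjn t1n.
move=> x1 x2 x3 x4 x5 x6 x7 x8 x9 x10 ln tn gjn t1n.
by field; rewrite ln tn gjn t1n sn gn.
Qed.

Lemma barrier_bound : Lam <=
  barrier_constant R d j * M ^+ n * gam ^+ d / (ell ^+ (2 * d) * gam ^+ j.+1 * S).
Proof.
have [z [Xz Tz cz pos zmax]] := max_point.
have Oz : Omega z by exact/sub/cyl_ball.
have T0 := max_off_axis Xz Tz cz pos zmax.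
apply: le_trans (detpsi Oz) _; rewrite -(bounds_product T0).
have [ee eo ze] := radial_unit oo T0.
set e := (radius d o (z - x0))^-1 *: _ in ee eo ze.
(* The completed basis is ordered: indices below [d] are axial, index [d] is the radial direction,
   and the remaining [j] are tangential. *)
have [||o' oo' o'E] := @orthonormal_complete _ _ d.+1
  (fun i => if i == d then e else o i).
- apply: orthonormal_upd => // i id; exact: (eo (Ordinal id)).
- by rewrite nE addnS ltnS leq_addr.
have o'd : o' d = e by rewrite o'E// eqxx.
have o'o i : (i < d)%N -> o' i = o i.
  by move=> id; rewrite o'E ?ltn_eqF// ltnS ltnW.
have d_n : (d < n)%N by rewrite nE addnS ltnS leq_addr.
have vE : z - x0 = axial d o (z - x0) + T z *: e.
  by rewrite /e scalerA mulfV ?gt_eqF// scale1r [RHS]addrC subrK.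
pose c (i : nat) : R := if (i < d)%N then axial_bound (T z)
  else if i == d then radial_bound (T z) else tangential_bound (T z).
(* Convexity enters Hadamard's inequality here: nonnegative second differences make the Hessian
   positive semidefinite. *)
have hess_psd : psd (hessian psi z).
  split; first exact: hessian_sym oO psiC2 Oz.
  move=> v; have [r r0 hr] := cyl_line v Xz Tz.
  apply: (quadform_hessian_ge oO psiC2 Oz r0) => s s0 sr; rewrite mul0r.
  apply: mid; apply: cyl_ball; first by apply: hr; rewrite gtr0_norm.
  by rewrite -scaleNr; apply: hr; rewrite normrN gtr0_norm.
have {}hess_psd : \det (hessian psi z) <= \prod_(i < n) c i.
  apply: (psd_det_le_prod hess_psd oo').
  move=> i; rewrite /c; case: (ltnP i d) => [id|di].
    by rewrite o'o//; exact: (axial_hessian (Ordinal id)).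
  case: eqVneq => [->|i_d].
    by rewrite o'd; apply: radial_hessian.
  have ortho (k : 'I_d) : dot (o' i) (o k) = 0.
    rewrite -(o'o k)// oo'//; last exact: ltn_trans d_n.
    by rewrite gtn_eqF// (leq_trans _ di).
  apply: tangential_hessian => //; first by rewrite oo'// eqxx.
  rewrite vE dotDl dotZl dotC dot_axial_l// add0r -o'd oo'//.
  by rewrite eq_sym (negbTE i_d) mulr0.
apply: le_trans hess_psd _; rewrite le_eqVlt; apply/orP; left; apply/eqP.
rewrite -(big_mkord xpredT c) (@big_cat_nat _ _ _ d)//=; last exact: ltnW.
congr (_ * _).
  rewrite (eq_big_nat _ _ (F2 := fun=> axial_bound (T z))) => [|i /andP[_ id]].
    by rewrite prodr_const_nat subn0.
  by rewrite /c id.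
rewrite big_ltn// {1}/c ltnn eqxx; congr (_ * _).
rewrite (eq_big_nat _ _ (F2 := fun=> tangential_bound (T z))) => [|i /andP[di _]].
  by rewrite prodr_const_nat nE addnS subSS addKn.
by rewrite /c ltnNge (ltnW di) /= gtn_eqF.
Qed.

End Barrier.

(** * From the barrier estimate to [phi] *)

(** The power of [gam] is pulled out with exponent [n - 2 d = (j + 1) - d], whose sign is not fixed;
    it is written as a quotient of natural powers to match [barrier_bound]. *)
Lemma phiE (R : realType) (n d j : nat) (delta gam : R) : n = (d + j.+1)%N ->
  0 < gam -> phi n d (delta / gam) =
  delta ^ (2 * d%:Z - n%:Z) * (gam ^+ j.+1 / gam ^+ d) * slope j d (delta / gam).
Proof.
move=> nE gam0; have gn : gam != 0 by rewrite gt_eqF.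
have jE : (n - d - 1)%N = j by rewrite nE addKn subn1.
rewrite /phi jE; congr (_ * _).
rewrite expfzMl exprz_inv; congr (_ * _).
rewrite (_ : - (2 * d%:Z - n%:Z) = j.+1%:Z - d%:Z); last by rewrite nE; lia.
by rewrite expfzDr// -exprnN.
Qed.

Theorem theorem1p6 (R : realType) (n d : nat)
    (hn : (3 <= n)%N) (hd : (1 <= d < n)%N) :
  exists C : R,
    forall (Omega : set 'rV[R]_n) (psi : 'rV[R]_n -> R) (lambda : R)
      (x0 : 'rV[R]_n) (delta : R) (M : R) (H : set 'rV[R]_n),
      open Omega ->
      C2_on Omega psi ->
      convex_on Omega psi ->
      (forall x, Omega x -> 0 <= psi x) ->
      0 < lambda ^- 2 ->
      (forall x, Omega x -> lambda ^- 2 <= \det (hessian psi x)) ->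
      Omega x0 ->
      psi x0 = 0 ->
      edist_to x0 (boundary Omega) = delta%:E ->
      0 < delta ->
      Linfty_norm Omega (grad psi) = M%:E ->
      affine_subspace d H ->
      H x0 ->
      forall ell : R, 0 < ell -> ell <= delta / 2 ->
        let gamma := sup [set psi x | x in eball x0 ell `&` H] / M in
        ell ^+ (2 * d) * phi n d (delta / gamma)
          <= C * lambda ^+ 2 * M ^+ n * delta ^ (2 * d%:Z - n%:Z).
Proof.
have [_ dn] := andP hd.
have [j nE] : exists j, n = (d + j.+1)%N.
  by exists (n - d).-1; rewrite prednK ?subn_gt0// subnKC// ltnW.
have C0 : 0 <= barrier_constant R d j by rewrite !mulr_ge0// exprn_ge0// addr_ge0.
(* The cylinder has half-height [delta / 2], so the barrier controls [slope] at [delta / 2 / gam];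
   doubling to [delta / gam] costs [4 ^+ j.+1]. *)
exists (barrier_constant R d j * 4 ^+ j.+1).
move=> Omega psi lambda x0 delta M H oO psiC2 cvx psi_ge0 lam0 hdet Ox0 psi0 dE
  delta0 LM [p [V [dimV HE]]] Hx0 ell ell0 elld; cbv zeta; set gam := sup _ / M.
have [M_ge0 gradM] := enorm_grad_le oO (C2_C1 psiC2) LM.
have sub := eball_sub_domain oO Ox0 dE.
have rhs_ge0 : 0 <= barrier_constant R d j * 4 ^+ j.+1 * lambda ^+ 2 * M ^+ n *
    delta ^ (2 * d%:Z - n%:Z).
  apply: mulr_ge0; last by rewrite exprz_ge0// ltW.
  apply: mulr_ge0; last exact: exprn_ge0.
  apply: mulr_ge0; last exact: sqr_ge0.
  by rewrite mulr_ge0// exprn_ge0.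
(* Division by zero yields 0, so [gam = 0] also covers [M = 0], and then [delta / gam] is 0. The
   integral over a one-point interval vanishes, and with it the left-hand side. *)
have [gamE|gam_neq0] := eqVneq gam 0.
  rewrite gamE invr0 mulr0 /phi set_itv1 Rintegral_set1 !mulr0//.
have M0 : 0 < M.
  rewrite lt_neqAle M_ge0 andbT; apply: contraNneq gam_neq0 => ME.
  by rewrite /gam -ME invr0 mulr0.
have bx0 : eball x0 delta x0 by rewrite /eball /= subrr enorm0.
have lip := lipschitz_on_eball oO (C2_C1 psiC2) gradM sub.
(* Makes [sup] a genuine supremum, and yields [gam <= ell <= delta / 2]. *)
have ub : ubound [set psi x | x in eball x0 ell `&` H] (M * ell).
  move=> _ [x [xl _] <-].
  have xd : eball x0 delta x by rewrite /eball /= (lt_trans xl)//; lra.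
  have := lip _ _ bx0 xd; rewrite psi0 subr0 => /le_trans; apply.
  by rewrite ler_pM2l// ltW.
have mem0 : [set psi x | x in eball x0 ell `&` H] (psi x0).
  by exists x0 => //; split=> //; rewrite /eball /= subrr enorm0.
have hub : has_ubound [set psi x | x in eball x0 ell `&` H] by exists (M * ell).
have gam0 : 0 < gam.
  rewrite lt_neqAle eq_sym gam_neq0 divr_ge0// -psi0.
  exact: ub_le_sup.
have gamd : gam <= delta / 2.
  rewrite /gam ler_pdivrMr// mulrC; apply: le_trans (ler_wpM2l M_ge0 elld).
  by apply: ge_sup ub; exists (psi x0).
have [f fo fV] : exists2 f, orthonormal d f & forall i, (i < d)%N -> f i \in V.
  by apply: exists_orthonormal_in; rewrite dimV.
have small v : enorm (axial d f v) < ell -> psi (x0 + axial d f v) <= gam * M.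
  move=> vl; rewrite /gam divfK ?gt_eqF//; apply: ub_le_sup => //.
  exists (x0 + axial d f v) => //; split.
    by rewrite /eball /= addrAC subrr add0r.
  move: Hx0; rewrite HE => -[u uV <-]; exists (u + axial d f v); last by rewrite addrA.
  by apply: memvD => //; apply: memv_suml => i _; apply: memvZ; exact: fV.
have mid x h := @midpoint_convex _ _ _ _ _ _ x h cvx sub.
have := barrier_bound nE oO psiC2 fo sub mid lip psi0 M0 gam0 ell0 elld gamd small hdet.
rewrite (phiE _ nE gam0).
have s0 : 0 < delta / 2 / gam by apply: divr_gt0 => //; exact: divr_gt0.
have := slope_double j d (ltW s0).
rewrite (_ : delta / 2 / gam *+ 2 = delta / gam); last by rewrite -mulr_natr; field.
have := slope_gt0 j d s0.
have : 0 < delta ^ (2 * d%:Z - n%:Z) by rewrite exprz_gt0.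
move: (slope j d (delta / 2 / gam)) (slope j d (delta / gam)) => S S2.
move: (delta ^ _) => q q0 S0 SS2 bound.
have l2 : 0 < lambda ^+ 2 by rewrite -invr_gt0.
have k0 : 0 < 4 ^+ j.+1 :> R by rewrite exprn_gt0.
have g1 : 0 < gam ^+ j.+1 by rewrite exprn_gt0.
have g2 : 0 < gam ^+ d by rewrite exprn_gt0.
have e2 : 0 < ell ^+ (2 * d) by rewrite exprn_gt0.
rewrite ler_pdivlMr ?mulr_gt0// mulrC ler_pdivrMr// in bound.
move: (ell ^+ (2 * d)) (gam ^+ j.+1) (gam ^+ d) (lambda ^+ 2) (M ^+ n)
  (barrier_constant R d j) (4 ^+ j.+1) k0 g1 g2 e2 l2 SS2 bound
  => e g h l m b k k0 g_gt0 h_gt0 e_gt0 l_gt0 SS2 bound.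
(* With denominators cleared, [bound] reads [e g S <= b m h l]; both sides of the goal share the
   positive factor [q / h], and [S2 <= k S] closes the gap. *)
have -> : e * (q * (g / h) * S2) = e * g * S2 * (q / h) by ring.
have -> : b * k * l * m * q = k * (b * m * h * l) * (q / h).
  by field; rewrite gt_eqF.
rewrite ler_pM2r ?divr_gt0//.
apply: le_trans (_ : k * (e * g * S) <= _); last by rewrite ler_pM2l.
by rewrite mulrCA ler_pM2l ?mulr_gt0.
Qed.
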